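(* (Plancherel formula) Given $\xi,\eta\in L\wr G$, we have $$(\xi,\eta)\;=\;\sum_{i\in[1,k]}\frac{x_id_i}{g}\cdot\operatorname{tr}_{K_i/K}\operatorname{Tr}_{K_i}\Big((\xi\omega_i)(\eta\omega_i)\Big).$$
   Context: A finite group $G$ acts (from the right, $y\mapsto y^\sigma$, by field automorphisms, not necessarily faithfully) on a field $L$ with fixed field $K$. Let $N$ be the kernel of this operation, $g=|G|$, $h=[L:K]$, $n=|N|$, so $g=hn$. Assume that $n$ is invertible in $K$. The twisted group ring $L\wr G$ is the $K$-algebra which as a right $L$-vector space has basis $G$, with multiplication determined by $(\sigma y)(\tau z)=(\sigma\tau)(y^\tau z)$. It is semisimple. The $K$-bilinear form $(-,=)$ on $L\wr G$ is defined by $(\sigma y,\tau z)=\delta_{\sigma,\tau^{-1}}\operatorname{Tr}_{L/K}(y^\tau z)$ for $\sigma,\tau\in G$, $y,z\in L$ ($\delta$ being the Kronecker delta). Let $X_1,\dots,X_k$ be representatives of the isomorphism classes of simple right $L\wr G$-modules, $K_i=\operatorname{End}_{L\wr G}X_i$ (a skew field, acting on $X_i$ from the left), $x_i$ the left $K_i$-dimension of $X_i$, $d_i^2=[K_i:Z(K_i)]$ with $d_i\ge1$. It is known that $x_id_i/h$ is an integer; $\frac{x_id_i}{g}$ denotes the element $\frac1n\cdot\frac{x_id_i}{h}$ of $K$. The map $\omega_i:L\wr G\to\operatorname{End}_{K_i}X_i$ is the operation of $L\wr G$ on $X_i$; maps are written and composed on the right. Choosing a $K_i$-basis, $X_i=K_i^{(x_i)}$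 is viewed as rows and $\operatorname{End}_{K_i}X_i$ as the ring of $x_i\times x_i$-matrices over $K_i$. $\operatorname{Tr}_{K_i}$ is the sum of the diagonal entries, and $\operatorname{tr}_{K_i/K}=\operatorname{Tr}_{Z(K_i)/K}\circ\operatorname{tr}_{K_i/Z(K_i)}$, where $\operatorname{tr}_{K_i/Z(K_i)}$ is the reduced trace; the composite $\operatorname{tr}_{K_i/K}\operatorname{Tr}_{K_i}$ is independent of the basis. *)

(* Defs.v *)
From HB Require Import structures.
From mathcomp Require Import all_boot all_order all_fingroup all_algebra all_field.

Set Implicit Arguments.
Unset Strict Implicit.
Unset Printing Implicit Defensive.

Import GRing.Theory.
Local Open Scope ring_scope.

(* A right action y^s = [to y s] of [G] on [L] by field automorphisms, not     *)
(* necessarily faithful, with fixed field [K] (embedded in [L] by a |-> a%:A). *)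
Record field_action (K : fieldType) (L : fieldExtType K) (G : finGroupType) :=
  FieldAction {
    fact :> {action G &-> L};
    fact_zmod : forall s, zmod_morphism (fact^~ s);
    fact_monoid : forall s, monoid_morphism (fact^~ s);
    fact_fixed : forall y, (forall s, fact y s = y) <-> (exists a : K, y = a%:A)
  }.

Section Action.

Variables (K : fieldType) (L : fieldExtType K) (G : finGroupType).
Variable to : field_action L G.

Definition fact_map (s : G) : L -> L := to^~ s.
HB.instance Definition _ s :=
  GRing.isZmodMorphism.Build L L (fact_map s) (fact_zmod to s).
HB.instance Definition _ s :=
  GRing.isMonoidMorphism.Build L L (fact_map s) (fact_monoid to s).

Lemma factr0 s : to 0 s = 0. Proof. exact: (rmorph0 (fact_map s)). Qed.
Lemma factr1 s : to 1 s = 1. Proof. exact: (rmorph1 (fact_map s)). Qed.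
Lemma factrD s : {morph to^~ s : y z / y + z}.
Proof. exact: (rmorphD (fact_map s)). Qed.
Lemma factrM s : {morph to^~ s : y z / y * z}.
Proof. exact: (rmorphM (fact_map s)). Qed.
Lemma factr_sum s (I : Type) (r : seq I) (P : pred I) (F : I -> L) :
  to (\sum_(i <- r | P i) F i) s = \sum_(i <- r | P i) to (F i) s.
Proof. exact: (rmorph_sum (fact_map s)). Qed.

Lemma fact1 y : to y 1%g = y.
Proof.
have [injto morphto] : is_action [set: G] to by case: (fact to).
by apply: (injto 1%g); rewrite -morphto ?inE // mulg1.
Qed.

Lemma factM y s t : to y (s * t)%g = to (to y s) t.
Proof.
have [_ morphto] : is_action [set: G] to by case: (fact to).
by rewrite morphto ?inE.
Qed.

Lemma factZ s (a : K) y : to (a *: y) s = a *: to y s.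
Proof.
rewrite -mulr_algl factrM /=.
have /fact_fixed -> : exists b : K, a%:A = b%:A :> L by exists a.
by rewrite mulr_algl.
Qed.

HB.instance Definition _ s :=
  GRing.isScalable.Build K L L *:%R (fact_map s) (factZ s).

Definition action_kernel : {set G} := [set s | linfun (fact_map s) == \1%VF].

Lemma action_kernelP s :
  reflect (forall y, to y s = y) (s \in action_kernel).
Proof.
rewrite inE; apply: (iffP eqP) => [/lfunP e y | e].
  by have := e y; rewrite lfunE id_lfunE.
by apply/lfunP => y; rewrite lfunE id_lfunE; apply: e.
Qed.

(* The function [xi] stands for \sum_s s (xi s), with coefficients in [L] on   *)
(* the right of the group elements.                                            *)
Definition twisted_group_ring of field_action L G := {ffun G -> L}.
Local Notation LG := (twisted_group_ring to).

HB.instance Definition _ := Vector.copy LG {ffun G -> L}.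

Implicit Types (s t : G) (y z : L) (xi eta : LG).

Definition tgr_elt s y : LG := [ffun t => if t == s then y else 0].

Definition tgr_one : LG := tgr_elt 1%g 1.
Definition tgr_mul xi eta : LG :=
  [ffun r : G => \sum_(s : G) to (xi s) (s^-1 * r)%g * eta (s^-1 * r)%g].

Fact tgr_mulA : associative tgr_mul.
Proof.
move=> a b c; apply/ffunP => r; rewrite !ffunE.
under eq_bigr => u _.
  rewrite ffunE mulr_sumr (reindex_inj (mulgI u^-1%g)) /=.
  over.
rewrite exchange_big /=; apply: eq_bigr => s _.
rewrite ffunE factr_sum mulr_suml /=.
apply: eq_bigr => u _.
rewrite factrM -factM -!mulgA invMg invgK.
by rewrite -!mulgA !mulKVg mulrA.
Qed.

Fact tgr_mul1l : left_id tgr_one tgr_mul.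
Proof.
move=> a; apply/ffunP => r; rewrite ffunE (bigD1 1%g) //= big1 => [|s /negPf s1].
  by rewrite ffunE eqxx factr1 mul1r invg1 mul1g addr0.
by rewrite ffunE s1 factr0 mul0r.
Qed.

Fact tgr_mul1r : right_id tgr_one tgr_mul.
Proof.
move=> a; apply/ffunP => r; rewrite ffunE (bigD1 r) //= big1 => [|s /negPf sr].
  by rewrite mulVg ffunE eqxx fact1 mulr1 addr0.
by rewrite ffunE -eq_mulVg1 sr mulr0.
Qed.

Fact tgr_mulDl : left_distributive tgr_mul +%R.
Proof.
move=> a b c; apply/ffunP => r; rewrite !ffunE -big_split /=.
by apply: eq_bigr => s _; rewrite ffunE factrD mulrDl.
Qed.

Fact tgr_mulDr : right_distributive tgr_mul +%R.
Proof.
move=> a b c; apply/ffunP => r; rewrite !ffunE -big_split /=.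
by apply: eq_bigr => s _; rewrite ffunE mulrDr.
Qed.

Fact tgr_one_neq0 : tgr_one != 0.
Proof. by apply/eqP => /ffunP/(_ 1%g)/eqP; rewrite !ffunE eqxx oner_eq0. Qed.

HB.instance Definition _ := GRing.Zmodule_isNzRing.Build LG
  tgr_mulA tgr_mul1l tgr_mul1r tgr_mulDl tgr_mulDr tgr_one_neq0.

Fact tgr_scaleAl (a : K) xi eta : a *: (xi * eta) = (a *: xi) * eta.
Proof.
apply/ffunP => r; rewrite !ffunE scaler_sumr.
by apply: eq_bigr => s _; rewrite ffunE factZ scalerAl.
Qed.
HB.instance Definition _ := GRing.Lmodule_isLalgebra.Build K LG tgr_scaleAl.

Fact tgr_scaleAr (a : K) xi eta : a *: (xi * eta) = xi * (a *: eta).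
Proof.
apply/ffunP => r; rewrite !ffunE scaler_sumr.
by apply: eq_bigr => s _; rewrite ffunE scalerAr.
Qed.
HB.instance Definition _ := GRing.Lalgebra_isAlgebra.Build K LG tgr_scaleAr.

HB.instance Definition _ := Algebra_isFalgebra.Build K LG.

Lemma tgr_eltM s t y z :
  tgr_elt s y * tgr_elt t z = tgr_elt (s * t)%g (to y t * z).
Proof.
apply/ffunP => r; rewrite !ffunE (bigD1 s) //= big1 => [|u /negPf us].
  rewrite !ffunE eqxx addr0; case: (r =P _) => [->|ne].
    by rewrite mulKg eqxx.
  by case: eqP => [e|]; [case: ne; rewrite -e mulKVg | rewrite mulr0].
by rewrite ffunE us factr0 mul0r.
Qed.

End Action.

(* The trace of the multiplication by [b], that is, Tr_{B/K} for a finite      *)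
(* field extension B of K.                                                     *)
Definition field_trace (K : fieldType) (B : falgType K) (b : B) : K :=
  \tr (passmx.mxof (vbasis {:B}) (vbasis {:B}) (amulr b)).

(* The K-bilinear extension of (s y, t z) = [s = t^-1] Tr_{L/K}(y^t z).        *)
Definition tgr_form (K : fieldType) (L : fieldExtType K) (G : finGroupType)
    (to : field_action L G) (xi eta : twisted_group_ring to) : K :=
  \sum_(s : G) \sum_(t : G)
    (s == t^-1%g)%:R * field_trace (to (xi s) t * eta t).

Lemma tgr_form_elt (K : fieldType) (L : fieldExtType K) (G : finGroupType)
    (to : field_action L G) (s t : G) (y z : L) :
  tgr_form (tgr_elt to s y) (tgr_elt to t z) =
    (s == t^-1%g)%:R * field_trace (to y t * z).
Proof.
have tr0 : field_trace (0 : L) = 0.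
  rewrite /field_trace.
  have -> : amulr (0 : L) = 0 by rewrite linear0.
  by rewrite /mxtrace big1 // => i _; rewrite !mxE /= zero_lfunE linear0.
rewrite /tgr_form (bigD1 s) //= [X in _ + X]big1 => [|u /negPf us]; last first.
  by apply: big1 => v _; rewrite ffunE us factr0 mul0r tr0 mulr0.
rewrite addr0 (bigD1 t) //= big1 => [|v /negPf vt].
  by rewrite !ffunE !eqxx addr0.
by rewrite [tgr_elt to t z v]ffunE vt mulr0 tr0 mulr0.
Qed.

(* Maps are written on the right, so [rmod_op (a * b)] is [rmod_op a] followed *)
(* by [rmod_op b]. Simple modules, being cyclic, are always of finite          *)
(* dimension over K.                                                           *)
Record right_module (K : fieldType) (A : falgType K) := RightModule {
  rmod_sort :> vectType K;
  rmod_op : {linear A -> 'End(rmod_sort)};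
  rmod_op1 : rmod_op 1 = \1%VF;
  rmod_opM : forall a b, rmod_op (a * b) = (rmod_op b \o rmod_op a)%VF
}.

Definition simple_rmod (K : fieldType) (A : falgType K) (X : right_module A) :=
  (fullv : {vspace X}) <> 0%VS /\
  (forall U : {vspace X}, (forall a, rmod_op X a @: U <= U)%VS ->
    U = 0%VS \/ U = fullv).

Record simple_module (K : fieldType) (A : falgType K) := SimpleModule {
  smod_rmod :> right_module A;
  smod_simple : simple_rmod smod_rmod
}.

Definition rmod_iso (K : fieldType) (A : falgType K) (X Y : right_module A) :=
  exists2 f : 'Hom(X, Y), bijective f &
    forall a, (f \o rmod_op X a = rmod_op Y a \o f)%VF.

Section Endo.

Variables (K : fieldType) (A : falgType K).

Definition rmod_comm (X : right_module A) : {vspace 'End(X)} :=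
  lker (linfun (fun f : 'End(X) =>
    linfun (fun a : A => (f \o rmod_op X a) - (rmod_op X a \o f))%VF)).

Lemma rmod_commP (X : right_module A) (f : 'End(X)) :
  reflect (forall a, f \o rmod_op X a = rmod_op X a \o f)%VF
          (f \in rmod_comm X).
Proof.
pose c (f : 'End(X)) (a : A) := ((f \o rmod_op X a) - (rmod_op X a \o f))%VF.
have clin g : linear (c g).
  move=> k a b; rewrite /c !linearP /= comp_lfunDl comp_lfunDr.
  by rewrite -comp_lfunZl -comp_lfunZr scalerBr opprD addrACA.
pose cL g := GRing.isLinear.Build K A 'End(X) *:%R (c g) (clin g).
pose cl g : {linear A -> 'End(X)} := HB.pack (c g) (cL g).
have clE g a : linfun (c g) a = c g a by rewrite -[c g]/(cl g : _ -> _) lfunE.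
have Clin : linear (fun g => linfun (c g)).
  move=> k g h; apply/lfunP => a.
  rewrite add_lfunE scale_lfunE !clE /c comp_lfunDl comp_lfunDr.
  by rewrite -comp_lfunZl -comp_lfunZr scalerBr opprD addrACA.
pose CL := GRing.isLinear.Build K 'End(X) 'Hom(A, 'End(X)) *:%R _ Clin.
pose Cl : {linear 'End(X) -> 'Hom(A, 'End(X))} := HB.pack (fun g => linfun (c g)) CL.
have ClE g : linfun (fun g => linfun (c g)) g = linfun (c g).
  by rewrite -[fun g => linfun (c g)]/(Cl : _ -> _) lfunE.
rewrite memv_ker [linfun _ f]ClE.
apply: (iffP eqP) => [/lfunP e a | e].
  by have := e a; rewrite clE zero_lfunE => /eqP; rewrite subr_eq0 => /eqP.
by apply/lfunP => a; rewrite clE zero_lfunE /c e subrr.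
Qed.

(* The skew field End_A(X), acting on [X] from the left: the product is        *)
(* (f * g) v = f (g v).                                                        *)
Definition endo (X : simple_module A) := subvs_of (rmod_comm X).

Variable X : simple_module A.
HB.instance Definition _ := Vector.copy (endo X) (subvs_of (rmod_comm X)).

Definition endo_app (f : endo X) (v : X) : X := vsval f v.

Implicit Types f g h : endo X.

Fact endo_one_subproof : \1%VF \in rmod_comm X.
Proof. by apply/rmod_commP => a; rewrite comp_lfun1l comp_lfun1r. Qed.
Definition endo_one : endo X := Subvs endo_one_subproof.

Fact endo_mul_subproof f g : (vsval f \o vsval g)%VF \in rmod_comm X.
Proof.
have /rmod_commP cf := subvsP f; have /rmod_commP cg := subvsP g.
by apply/rmod_commP => a; rewrite -comp_lfunA cg comp_lfunA cf comp_lfunA.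
Qed.
Definition endo_mul f g : endo X := Subvs (endo_mul_subproof f g).

Fact endo_mulA : associative endo_mul.
Proof. by move=> f g h; apply/val_inj/comp_lfunA. Qed.
Fact endo_mul1l : left_id endo_one endo_mul.
Proof. by move=> f; apply/val_inj/comp_lfun1l. Qed.
Fact endo_mul1r : right_id endo_one endo_mul.
Proof. by move=> f; apply/val_inj/comp_lfun1r. Qed.
Fact endo_mulDl : left_distributive endo_mul +%R.
Proof. by move=> f g h; apply/val_inj/comp_lfunDl. Qed.
Fact endo_mulDr : right_distributive endo_mul +%R.
Proof. by move=> f g h; apply/val_inj/comp_lfunDr. Qed.
Fact endo_one_neq0 : endo_one != 0.
Proof.
apply/eqP => /(congr1 val) /= /lfunP e; case: (smod_simple X) => + _; apply.
apply/vspaceP => v; rewrite memvf memv0.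
by have := e v; rewrite id_lfunE zero_lfunE => ->; rewrite eqxx.
Qed.

HB.instance Definition _ := GRing.Zmodule_isNzRing.Build (endo X)
  endo_mulA endo_mul1l endo_mul1r endo_mulDl endo_mulDr endo_one_neq0.

Fact endo_scaleAl (a : K) f g : a *: (f * g) = (a *: f) * g.
Proof. exact/val_inj/comp_lfunZl. Qed.
HB.instance Definition _ := GRing.Lmodule_isLalgebra.Build K (endo X) endo_scaleAl.

Fact endo_scaleAr (a : K) f g : a *: (f * g) = f * (a *: g).
Proof. exact/val_inj/comp_lfunZr. Qed.
HB.instance Definition _ := GRing.Lalgebra_isAlgebra.Build K (endo X) endo_scaleAr.

HB.instance Definition _ := Algebra_isFalgebra.Build K (endo X).

Lemma endo_mulE f g v : endo_app (f * g) v = endo_app f (endo_app g v).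
Proof. exact: comp_lfunE. Qed.

(* A basis of [X] over the skew field [endo X], with the resulting             *)
(* identification of [X] with rows; [x] is then the left dimension of [X].     *)
Record endo_basis (x : nat) := EndoBasis {
  ebasis :> 'I_x -> X;
  ecoord : X -> 'rV[endo X]_x;
  ecoordK : forall v, \sum_(j < x) endo_app (ecoord v 0 j) (ebasis j) = v;
  ecombK : forall r : 'rV[endo X]_x,
    ecoord (\sum_(j < x) endo_app (r 0 j) (ebasis j)) = r
}.

(* The operation A -> End_{endo X}(X), read as matrices acting on rows.        *)
Definition omega x (b : endo_basis x) (a : A) : 'M[endo X]_x :=
  \matrix_(j < x) ecoord b (rmod_op X a (b j)).

End Endo.

Definition center_type (K : fieldType) (D : falgType K) :=
  subvs_of 'Z({:D})%AS.

(* [trd] is the reduced trace of the skew field [D] over its center Z: for     *)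
(* some extension iota : Z -> E and some E-algebra isomorphism from D (x)_Z E  *)
(* to the matrices of size m.+1 over E, [trd] is the trace of the resulting    *)
(* matrix. The isomorphism is given by its restriction phi to D: the induced   *)
(* map on D (x)_Z E is surjective, and both sides have E-dimension m.+1 ^ 2.   *)
Definition reduced_trace (K : fieldType) (D : falgType K)
    (trd : D -> center_type D) : Prop :=
  exists (E : fieldType) (iota : {rmorphism center_type D -> E})
         (m : nat) (phi : {rmorphism D -> 'M[E]_m.+1}),
    [/\ forall z, phi (vsval z) = (iota z)%:M,
        (m.+1 ^ 2)%N = \dim_('Z({:D})) {:D},
        forall M : 'M[E]_m.+1, exists s : seq (E * D),
          M = \sum_(p <- s) p.1 *: phi p.2
      & forall u, \tr (phi u) = iota (trd u)].

(* Main.v *)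
(* With Tr = Tr_{L/K}, the form is (xi, eta) = t(xi eta) for t(a) = Tr(a_1).          *)
(* The claim says that t is a combination of reduced characters. Pick y in L with     *)
(* Tr(y) = 1/n. Computed in the basis of the elements s v_j, the K-trace of the map   *)
(* c |-> a c y of L wr G is n Tr(y) t(a) = t(a); unlike a comparison with the regular *)
(* representation, this requires n, but not g, to be invertible. The same map can be  *)
(* computed after the Wedderburn isomorphism with the product of the matrix rings     *)
(* M_{x_i}(K_i): on such a ring, c |-> m c m' has K-trace Tr_{Z/K}(trd(m) trd(m')),   *)
(* with trd the reduced trace (after splitting, this is tr(m) tr(m')). Finally,       *)
(* trd(y omega_i) = (x_i d_i / h) Tr(y): over a splitting field containing L, the     *)
(* idempotents of L cut the space of dimension x_i d_i into h eigenspaces of L, which *)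
(* are permuted transitively by G and hence have equal dimension.                     *)

(* The Wedderburn isomorphism is built from the modules themselves. Surjectivity of a |-> (omega (b
   i) a)_i is [omega_surj], which applies Jacobson density to all basis vectors of all the [X i]
   together. Injectivity comes from [tgr_semisimple]: t is a symmetrizing form, and the formula
   [tgr_trace_mull_mulr] for the trace of c |-> a c y also says that the Casimir element of t, with
   y inserted, multiplies out to 1, which is what Maschke's averaging needs ([tgr_maschke]). Traces
   are computed in dual systems and compared by [trace_dual_system]. The trace on a single skew
   field is [reduced_trace_dual_system]; the value of trd(y omega_i) is [reduced_trace_omega], which
   rests on the eigenspace count [tgr_rep_trace]. *)
From HB Require Import structures.
Require Import Defs.
From mathcomp Require Import all_boot all_order all_fingroup all_algebra all_field.
From Stdlib Require Import Classical_Prop.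
Import GRing.Theory.
Local Open Scope ring_scope.

Set Implicit Arguments.
Unset Strict Implicit.
Unset Printing Implicit Defensive.

(** * Linear algebra *)

Lemma sum_sig (V : nmodType) (I : finType) (J : I -> finType) (F : {i & J i} -> V) :
  \sum_p F p = \sum_i \sum_(j : J i) F (Tagged J j).
Proof.
rewrite (sig_big_dep xpredT (fun=> xpredT) (fun i j => F (Tagged J j))) /=.
by apply: eq_bigr => -[].
Qed.

Section LinearSums.

Variables (R : comNzRingType) (U V : lmodType R).

Lemma linear_sumZ (f : U -> V) (I : finType) (c : I -> R) (u : I -> U) :
  linear f -> f (\sum_i c i *: u i) = \sum_i c i *: f (u i).
Proof.
move=> fL; pose g : {linear U -> V} := HB.pack f (GRing.isLinear.Build _ _ _ _ f fL).
rewrite -[f]/(g : _ -> _) linear_sum.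
by apply: eq_bigr => i _; rewrite linearZ.
Qed.

Lemma linearZ_of (f : U -> V) a u : linear f -> f (a *: u) = a *: f u.
Proof.
move=> fL; have := linear_sumZ (I := 'I_1) (fun=> a) (fun=> u) fL.
by rewrite !big_ord1.
Qed.

Lemma linearB_of (f : U -> V) u v : linear f -> f (u - v) = f u - f v.
Proof. by move=> fL; rewrite addrC -scaleN1r fL scaleN1r addrC. Qed.

Lemma scalar_sumZ (f : U -> R) (I : finType) (c : I -> R) (u : I -> U) :
  scalar f -> f (\sum_i c i *: u i) = \sum_i c i * f (u i).
Proof.
move=> fL; pose g : {scalar U} := HB.pack f (GRing.isLinear.Build _ _ _ _ f fL).
rewrite -[f]/(g : _ -> _) linear_sum.
by apply: eq_bigr => i _; rewrite linearZ.
Qed.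

Lemma scalarZ_of (f : U -> R) a u : scalar f -> f (a *: u) = a * f u.
Proof.
move=> fL; have := scalar_sumZ (I := 'I_1) (fun=> a) (fun=> u) fL.
by rewrite !big_ord1.
Qed.

Lemma scalar_sum_of (f : U -> R) (I : finType) (u : I -> U) :
  scalar f -> f (\sum_i u i) = \sum_i f (u i).
Proof.
move=> fL; have := scalar_sumZ (fun=> 1) u fL.
under eq_bigr do rewrite scale1r.
by move=> ->; apply: eq_bigr => i _; rewrite mul1r.
Qed.

(** The identity of [U] written as a sum of rank-one maps, so that [\sum_i f i (phi (u i))] is the
    trace of [phi]. *)
Definition dual_system (I : finType) (u : I -> U) (f : I -> U -> R) :=
  (forall i, scalar (f i)) /\ (forall w, w = \sum_i f i w *: u i).

(* [u] need not be free: both sides are the trace of [phi], by Tr(AB) = Tr(BA). *)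
Lemma trace_dual_system (I J : finType) (u : I -> U) f (v : J -> U) g phi :
  dual_system u f -> dual_system v g -> linear phi ->
  \sum_i f i (phi (u i)) = \sum_j g j (phi (v j)).
Proof.
move=> [fL fE] [gL gE] pL.
under eq_bigr => i _ do rewrite [phi (u i)]gE scalar_sumZ //.
rewrite exchange_big /=; apply: eq_bigr => j _.
rewrite [in RHS](fE (v j)).
have gpL : scalar (fun w => g j (phi w)).
  by move=> a x y; rewrite pL gL.
rewrite (scalar_sumZ _ _ gpL).
by apply: eq_bigr => i _; rewrite mulrC.
Qed.

End LinearSums.

Section VectDual.

Variables (K : fieldType) (V : vectType K).
Local Notation e := (vbasis {:V}).

Lemma coord_dual_system : dual_system (fun i : 'I_(\dim {:V}) => e`_i) (coord e).
Proof.
split=> [i a v w|w]; first by rewrite linearP.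
exact: (coord_basis (vbasisP _) (memvf _)).
Qed.

(** Nondegeneracy makes the Gram matrix of [f] invertible; the columns of its inverse give the
    vectors that represent the coordinate functionals. *)
Lemma dual_basis (f : V -> V -> K) :
  (forall v, scalar (f v)) -> (forall v, scalar (f^~ v)) ->
  (forall v, (forall w, f v w = 0) -> v = 0) ->
  exists v' : 'I_(\dim {:V}) -> V, forall w i, coord e i w = f w (v' i).
Proof.
move=> fR fL nd.
pose M : 'M[K]_(\dim {:V}) := \matrix_(i, j) f e`_i e`_j.
have Mu : M \in unitmx.
  rewrite -row_free_unit; apply/inj_row_free => c cM.
  have w0 : \sum_i c 0 i *: e`_i = 0.
    apply: nd => w; rewrite [w](coord_basis (vbasisP _) (memvf _)).
    rewrite scalar_sumZ // big1 // => j _.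
    have -> : f (\sum_i c 0 i *: e`_i) e`_j = (c *m M) 0 j.
      rewrite mxE [LHS](scalar_sumZ _ _ (fL _)).
      by apply: eq_bigr => i _; rewrite mxE.
    by rewrite cM mxE mulr0.
  apply/rowP => i; rewrite mxE.
  by rewrite -(coord_sum_free (c 0) i (basis_free (vbasisP {:V}))) w0 linear0.
exists (fun i => \sum_l invmx M l i *: e`_l) => w i.
have fE (j : 'I__) : f e`_j (\sum_l invmx M l i *: e`_l) = (j == i)%:R.
  have <- : (M *m invmx M) j i = (j == i)%:R by rewrite mulmxV // mxE.
  rewrite scalar_sumZ // mxE.
  by apply: eq_bigr => l _; rewrite [in RHS]mxE mulrC.
rewrite [in RHS](coord_basis (vbasisP _) (memvf w)).
rewrite [RHS](scalar_sumZ _ _ (fL _)) /=.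
rewrite (bigD1 i) //= [X in _ + X]big1 => [|j /negPf ji].
  by rewrite fE eqxx mulr1 addr0.
by rewrite fE ji mulr0.
Qed.

End VectDual.

Lemma field_traceE (K : fieldType) (B : falgType K) (b : B) :
  field_trace b = \sum_i coord (vbasis {:B}) i ((vbasis {:B})`_i * b).
Proof.
rewrite /field_trace /mxtrace; apply: eq_bigr => i _.
by rewrite mxE /= mxE passmx.vecof_delta lfunE.
Qed.

Lemma field_trace_dual_system (K : fieldType) (B : falgType K) (b : B)
    (I : finType) (u : I -> B) f : dual_system u f ->
  field_trace b = \sum_i f i (u i * b).
Proof.
move=> uf; rewrite field_traceE.
apply: (trace_dual_system (phi := fun y => y * b) (coord_dual_system B) uf).
by move=> a x y; rewrite mulrDl scalerAl.
Qed.

Lemma field_trace_scalar (K : fieldType) (B : falgType K) : scalar (@field_trace K B).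
Proof.
move=> a x y; rewrite !field_traceE mulr_sumr -big_split /=.
by apply: eq_bigr => i _; rewrite mulrDr -scalerAr linearP.
Qed.

(** Artin's argument, by induction on the number of characters: the relation at [z * y] minus
    [chi j z] times the relation at [y] has no term in [j], so by induction each other [a l]
    vanishes unless [chi l] and [chi j] agree. *)
Lemma dedekind_independence (A : nzRingType) (F : fieldType) (I : finType)
    (chi : I -> A -> F) (c : I -> F) :
  (forall i, monoid_morphism (chi i)) -> (forall i j, chi i =1 chi j -> i = j) ->
  (forall y, \sum_i c i * chi i y = 0) -> forall i, c i = 0.
Proof.
move=> chiM chi_inj c0 i.
have: forall n (P : {set I}) (a : I -> F), (#|P| <= n)%N ->
    (forall y, \sum_(j in P) a j * chi j y = 0) -> forall j, j \in P -> a j = 0.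
  elim=> [|n IHn] P a Pn a0 j jP.
    by move: Pn; rewrite leqn0 cards_eq0 => /eqP P0; rewrite P0 inE in jP.
  have ak k : k \in P :\ j -> a k = 0.
    move=> kPj; have [kj kP] := setD1P kPj.
    apply/eqP; apply: contraNT kj => ak0; apply/eqP; apply: chi_inj => z.
    have Pjn : (#|P :\ j| <= n)%N by rewrite (cardsD1 j P) jP in Pn.
    have /IHn/(_ k kPj)/eqP: forall y,
        \sum_(l in P :\ j) a l * (chi l z - chi j z) * chi l y = 0.
      move=> y.
      have := a0 (z * y); rewrite (big_setD1 j) //= => e1.
      have := a0 y; rewrite (big_setD1 j) //= => e2.
      under eq_bigr => l _.
        have -> : a l * (chi l z - chi j z) * chi l y =
            a l * chi l (z * y) - chi j z * (a l * chi l y).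
          by rewrite (chiM l).2 mulrBr mulrBl -!mulrA; congr (_ - _); rewrite mulrCA.
        over.
      rewrite sumrB -mulr_sumr.
      move/eqP: e1; rewrite addrC addr_eq0 => /eqP ->.
      move/eqP: e2; rewrite addrC addr_eq0 => /eqP ->.
      by rewrite (chiM j).2 mulrN opprK mulrCA addNr.
    by rewrite mulf_eq0 (negPf ak0) subr_eq0 => /(_ Pjn) /eqP.
  have := a0 1; rewrite (big_setD1 j) //= big1 ?addr0 => [|k kPj].
    by rewrite (chiM j).1 mulr1.
  by rewrite ak ?mul0r.
move=> /(_ #|I| setT c); apply; rewrite ?inE ?max_card // => y.
by rewrite -[RHS](c0 y); apply: eq_bigl => j; rewrite inE.
Qed.

(** * The Galois extension L/K *)

Section FieldAction.

Variables (K : fieldType) (L : fieldExtType K) (G : finGroupType).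
Variable to : field_action L G.
Local Notation N := (action_kernel to).

Lemma action_kernel_group_set : group_set N.
Proof.
apply/group_setP; split=> [|s t /action_kernelP sN /action_kernelP tN].
  by apply/action_kernelP => y; rewrite fact1.
by apply/action_kernelP => y; rewrite factM sN tN.
Qed.
Local Notation NG := (Group action_kernel_group_set).

Lemma rcoset_action_kernelP s t :
  reflect (forall y, to y s = to y t) (s \in (NG :* t)%g).
Proof.
rewrite mem_rcoset; apply: (iffP (action_kernelP _ _)) => e y.
  by rewrite -[in RHS](e y) -factM mulgKV.
by rewrite factM e -factM mulgV fact1.
Qed.

(** The order of G/N, the Galois group of L over K; [galois_rep] picks one element of [G] for each
    automorphism of L that occurs. *)
Definition galois_index := #|rcosets NG [set: G]|.
Definition galois_rep (c : 'I_galois_index) : G := repr (enum_val c).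

Lemma galois_rep_coset c : (NG :* galois_rep c)%g = enum_val c.
Proof.
have /rcosetsP[s _ e] := enum_valP c.
by rewrite /galois_rep e; apply: (@rcoset_repr _ NG).
Qed.

Lemma galois_rep_inj c c' :
  (forall y, to y (galois_rep c) = to y (galois_rep c')) -> c = c'.
Proof.
move=> /rcoset_action_kernelP /rcoset_eqP.
by rewrite !galois_rep_coset => /enum_val_inj.
Qed.

Lemma galois_rep_onto s : exists c, forall y, to y s = to y (galois_rep c).
Proof.
have sC : (NG :* s)%g \in rcosets NG [set: G].
  by apply/rcosetsP; exists s; rewrite ?inE.
exists (enum_rank_in sC (NG :* s)%g); apply/rcoset_action_kernelP.
by rewrite galois_rep_coset enum_rankK_in ?rcoset_refl.
Qed.

Lemma sum_galois_rep (V : nmodType) (F : G -> V) :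
  (forall s t, (forall y, to y s = to y t) -> F s = F t) ->
  \sum_s F s = (\sum_c F (galois_rep c)) *+ #|N|.
Proof.
move=> FP; rewrite (eq_bigl (fun s => s \in [set: G])) => [|s]; last by rewrite inE.
rewrite (set_partition_big _ (rcosets_partition (subsetT NG))).
rewrite -sumrMnl big_enum_val /=; apply: eq_bigr => c _.
rewrite -galois_rep_coset.
under eq_bigr => s /rcoset_action_kernelP/FP -> do [].
by rewrite sumr_const card_rcoset.
Qed.

Lemma in_alg_inj : injective (fun a : K => a%:A : L).
Proof. exact: fmorph_inj (in_alg L). Qed.

Hypothesis n_unit : (#|N|%:R : K) != 0.

(** Dividing by n turns the sum over G into a sum over G/N. The boolean equation lets [xchoose]
    extract the scalar. *)
Lemma fact_trace_fixed y :
  exists a : K, (#|N|%:R^-1 : K) *: \sum_s to y s == a%:A.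
Proof.
have /fact_fixed [a ->] : forall t, to (#|N|%:R^-1 *: \sum_s to y s) t =
    #|N|%:R^-1 *: \sum_s to y s.
  move=> t; rewrite factZ factr_sum; congr (_ *: _).
  rewrite [RHS](reindex_inj (mulIg t)).
  by apply: eq_bigr => s _; rewrite factM.
by exists a.
Qed.

(** The trace as a sum of conjugates; [galois_trace_field_trace] identifies it with
    [field_trace]. *)
Definition galois_trace (y : L) : K := xchoose (fact_trace_fixed y).
Local Notation T := galois_trace.

Lemma galois_traceE y : (T y)%:A = (#|N|%:R^-1 : K) *: \sum_s to y s.
Proof. exact/esym/eqP/(xchooseP (fact_trace_fixed y)). Qed.

Lemma galois_trace_rep y : (T y)%:A = \sum_c to y (galois_rep c).
Proof.
rewrite galois_traceE (sum_galois_rep (F := fun s => to y s)) //.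
by rewrite -scaler_nat scalerA mulVf // scale1r.
Qed.

Lemma galois_trace_scalar : scalar T.
Proof.
move=> a y z; apply: in_alg_inj; rewrite /= scalerDl -scalerA !galois_traceE.
under eq_bigr => s _ do rewrite factrD factZ.
by rewrite big_split /= -scaler_sumr scalerDr !scalerA [_ * a]mulrC.
Qed.

Lemma galois_trace_fact y s : T (to y s) = T y.
Proof.
apply: in_alg_inj; rewrite /= !galois_traceE; congr (_ *: _).
rewrite [RHS](reindex_inj (mulgI s)).
by apply: eq_bigr => t _; rewrite factM.
Qed.

Lemma galois_trace_sum y : \sum_s to y s = (#|N|%:R * T y)%:A.
Proof. by rewrite -scalerA galois_traceE scalerA mulfV // scale1r. Qed.

Lemma fact_independence (c : 'I_galois_index -> L) :
  (forall y, \sum_i c i * to y (galois_rep i) = 0) -> forall i, c i = 0.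
Proof.
apply: (dedekind_independence (chi := fun i y => to y (galois_rep i))).
  by move=> i; split=> [|y z]; rewrite ?factr1 ?factrM.
by move=> i j; apply: galois_rep_inj.
Qed.

Lemma galois_index_gt0 : (0 < galois_index)%N.
Proof. by have [c _] := galois_rep_onto 1%g; case: (galois_index) c => [[]|]. Qed.

(** The hypothesis reads \sum_c y^c z^c = 0 for all z, so Dedekind independence kills every y^c. *)
Lemma galois_trace_nondegenerate y : (forall z, T (y * z) = 0) -> y = 0.
Proof.
move=> Ty0; have [c _] := galois_rep_onto 1%g.
have e := @fact_independence (fun i => to y (galois_rep i)).
have/e/(_ c) : forall z, \sum_i to y (galois_rep i) * to z (galois_rep i) = 0.
  move=> z; under eq_bigr do rewrite -factrM.
  by rewrite -galois_trace_rep Ty0 scale0r.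
move=> yc0; have := congr1 (fun z => to z (galois_rep c)^-1%g) yc0.
by rewrite -factM mulgV fact1 factr0.
Qed.

Local Notation h := (\dim {:L}).
Local Notation e := (vbasis {:L}).

Lemma galois_dual_basis : exists v' : 'I_h -> L,
  [/\ dual_system (fun i : 'I_h => e`_i) (fun i y => T (v' i * y)),
      dual_system v' (fun (i : 'I_h) y => T (y * e`_i)),
      \sum_i v' i * e`_i = 1 &
      forall c c', \sum_i to (v' i) (galois_rep c) * to e`_i (galois_rep c') = (c == c')%:R].
Proof.
have TL v : scalar (fun y => T (v * y)).
  by move=> a y z; rewrite mulrDr -scalerAr galois_trace_scalar.
have TL' v : scalar (fun y => T (y * v)).
  by move=> a y z; rewrite mulrDl -scalerAl galois_trace_scalar.
have [v' v'E] := dual_basis TL TL' galois_trace_nondegenerate.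
have v'sys : dual_system (fun i : 'I_h => e`_i) (fun i y => T (v' i * y)).
  split=> // w; rewrite [LHS](coord_basis (vbasisP _) (memvf _)).
  by apply: eq_bigr => i _; rewrite v'E mulrC.
(* Expanding y in the basis, with [T] a sum of conjugates, gives y^c' = \sum_c (\sum_i v'_i^c
   e_i^c') y^c; independence allows comparing coefficients. *)
have delta c c' : \sum_i to (v' i) (galois_rep c) * to e`_i (galois_rep c') = (c == c')%:R.
  apply/eqP; rewrite -subr_eq0; apply/eqP; move: c.
  apply: fact_independence => y.
  under eq_bigr do rewrite mulrBl mulr_suml.
  rewrite sumrB [X in _ - X](bigD1 c') //= eqxx mul1r [X in _ - (_ + X)]big1 => [|i /negPf ->].
    apply/eqP; rewrite addr0 subr_eq0 [X in _ == to X _]v'sys.2 factr_sum exchange_big /=.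
    apply/eqP/eq_bigr => i _.
    rewrite factZ -mulr_algl galois_trace_rep mulr_suml.
    by apply: eq_bigr => c _; rewrite factrM mulrAC.
  by rewrite mul0r.
exists v'; split=> //.
  split=> // y; apply/eqP; rewrite -subr_eq0; apply/eqP/galois_trace_nondegenerate => z.
  rewrite mulrBl -scaleN1r [_ + _]addrC galois_trace_scalar mulN1r addrC.
  rewrite [in T (y * z)](v'sys.2 z) mulr_sumr mulr_suml !(scalar_sum_of _ galois_trace_scalar).
  apply/eqP; rewrite subr_eq0; apply/eqP/eq_bigr => i _.
  by rewrite -scalerAr -scalerAl !(scalarZ_of _ _ galois_trace_scalar) mulrC.
have [c ce] := galois_rep_onto 1%g.
transitivity ((c == c)%:R : L); last by rewrite eqxx.
rewrite -delta.
by apply: eq_bigr => i _; rewrite -!ce !fact1.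
Qed.

(** This is [L:K] = |G/N|: the matrices of conjugates of the basis and of its dual are inverse to
    each other, hence square. *)
Lemma galois_index_dim : galois_index = h.
Proof.
have [v' [v'sys _ _ v'rep]] := galois_dual_basis.
pose V := \matrix_(i < h, c < galois_index) to e`_i (galois_rep c).
pose W := \matrix_(c < galois_index, i < h) to (v' i) (galois_rep c).
have WV : W *m V = 1%:M.
  apply/matrixP => c c'; rewrite !mxE -v'rep.
  by apply: eq_bigr => i _; rewrite !mxE.
have VW : V *m W = 1%:M.
  apply/matrixP => i j; rewrite !mxE.
  have := coord_free i j (basis_free (vbasisP {:L})).
  rewrite [X in coord _ _ X]v'sys.2 /=.
  rewrite -[X in coord _ _ X]/(\sum_(k < h) _) coord_sum_free ?(basis_free (vbasisP _)) //.
  move=> /(congr1 (fun a : K => a%:A : L)); rewrite scaler_nat.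
  rewrite galois_trace_rep => <-.
  by apply: eq_bigr => c _; rewrite !mxE factrM mulrC.
by apply/eqP; rewrite eqn_leq (mulmx1_min WV) (mulmx1_min VW).
Qed.

(** In the dual system of the trace form, multiplication by [y] has trace \sum_i T(v'_i e_i y), and
    \sum_i v'_i e_i = 1. *)
Lemma galois_trace_field_trace y : field_trace y = T y.
Proof.
have [v' [v'sys _ v'1 _]] := galois_dual_basis.
rewrite (field_trace_dual_system _ v'sys) -[y in RHS]mul1r -v'1 mulr_suml.
rewrite (scalar_sum_of _ galois_trace_scalar).
by apply: eq_bigr => i _; rewrite mulrA.
Qed.

(** Nondegeneracy at 1 makes [T] nonzero, so a multiple of some basis vector reaches any value. The
    value 1/n is chosen to cancel the factor n in \sum_s y^s = n T(y). *)
Lemma galois_trace_surj : exists y, T y = #|N|%:R^-1.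
Proof.
have [/eqfunP T0|] := boolP [forall i : 'I_h, T e`_i == 0]; last first.
  case/forallPn=> i Ti; exists ((#|N|%:R^-1 / T e`_i) *: e`_i).
  by rewrite (scalarZ_of _ _ galois_trace_scalar) divfK.
have [] := negP (oner_neq0 L); apply/eqP/galois_trace_nondegenerate => z.
rewrite mul1r [z](coord_basis (vbasisP _) (memvf _)).
rewrite (scalar_sumZ _ _ galois_trace_scalar) big1 // => i _.
by rewrite T0 mulr0.
Qed.

End FieldAction.

(** * Right ideals *)

Section RightIdeals.

Variables (K : fieldType) (A : falgType K).

Definition right_ideal (M : {vspace A}) := forall a b, a \in M -> a * b \in M.

Section Module.

Variable M : {vspace A}.
Hypothesis M_ideal : right_ideal M.

Definition rideal_op (a : A) : 'End(subvs_of M) :=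
  (linfun (vsproj M) \o amulr a \o linfun vsval)%VF.

Lemma rideal_opE a v : vsval (rideal_op a v) = vsval v * a.
Proof. by rewrite !comp_lfunE !lfunE /= vsprojK // M_ideal // subvsP. Qed.

Fact rideal_op_linear : linear rideal_op.
Proof.
move=> c a b; apply/lfunP => v; apply: (@subvs_inj _ _ M); rewrite add_lfunE scale_lfunE.
by rewrite [RHS]linearP /= !rideal_opE mulrDr scalerAr.
Qed.

Definition rideal_op_lin : {linear A -> 'End(subvs_of M)} :=
  HB.pack rideal_op (GRing.isLinear.Build _ _ _ _ rideal_op rideal_op_linear).

Fact rideal_op1 : rideal_op_lin 1 = \1%VF.
Proof. by apply/lfunP => v; apply: val_inj; rewrite /= rideal_opE mulr1 lfunE. Qed.

Fact rideal_opM a b :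
  rideal_op_lin (a * b) = (rideal_op_lin b \o rideal_op_lin a)%VF.
Proof.
by apply/lfunP => v; apply: val_inj; rewrite /= comp_lfunE !rideal_opE mulrA.
Qed.

Definition rideal_module : right_module A := RightModule rideal_op1 rideal_opM.

Lemma rideal_module_simple : M <> 0%VS ->
  (forall U : {vspace A}, right_ideal U -> (U <= M)%VS -> U = 0%VS \/ U = M) ->
  simple_rmod rideal_module.
Proof.
move=> M0 Mmin; split=> [/= f0|/= U Ustab].
  apply: M0; apply/eqP; rewrite -subv0; apply/subvP => a aM.
  have : Subvs aM \in (fullv : {vspace subvs_of M}) by rewrite memvf.
  by rewrite f0 !memv0 => /eqP/(congr1 (@vsval _ _ M)) /= ->.
have imP a : reflect (exists2 v, v \in U & a = vsval v) (a \in (linfun vsval @: U)%VS).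
  by apply: (iffP memv_imgP) => -[v vU ->]; exists v; rewrite ?lfunE.
have [| |U0|UM] := Mmin (linfun vsval @: U)%VS.
- move=> a b /imP [v vU ->]; apply/imP; exists (rideal_op b v); rewrite ?rideal_opE //.
  by apply: (subvP (Ustab b)); apply: memv_img.
- by apply/subvP => a /imP [v _ ->]; apply: subvsP.
- left; apply/eqP; rewrite -subv0; apply/subvP => v vU.
  have : vsval v \in (linfun vsval @: U)%VS by apply/imP; exists v.
  by rewrite U0 !memv0 => /eqP v0; apply/eqP/val_inj.
- right; apply/vspaceP => v; rewrite memvf.
  have : vsval v \in (linfun vsval @: U)%VS by rewrite UM subvsP.
  by case/imP => w wU /val_inj ->.
Qed.

End Module.

(* The first hypothesis is what Maschke's averaging provides. Every right ideal is  *)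
(* annihilated by [a]: it is either simple or the sum of two smaller right ideals.  *)
Lemma semisimple_annihilator (a : A) :
  (forall U : {vspace A}, right_ideal U -> exists pi : 'End(A),
    [/\ forall b c, pi (b * c) = pi b * c, forall b, pi b \in U &
        forall b, b \in U -> pi b = b]) ->
  (forall Y : simple_module A, rmod_op Y a = 0) -> a = 0.
Proof.
move=> maschke Ya0.
suff H n (M : {vspace A}) : (\dim M < n)%N -> right_ideal M ->
    forall m, m \in M -> m * a = 0.
  rewrite -[a]mul1r; apply: (H (\dim {:A}).+1 fullv _ _ 1) => //; rewrite ?memvf //.
  by move=> b c _; rewrite memvf.
elim: n => // n IHn in M *; rewrite ltnS => Mn Mid m mM.
have [//|ma0] := eqVneq (m * a) 0.
have M0 : M <> 0%VS.
  by move=> M0; move: mM ma0; rewrite M0 memv0 => /eqP ->; rewrite mul0r eqxx.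
suff Msimple : simple_rmod (rideal_module Mid).
  have := congr1 (fun f : 'End(_) => vsval (f (Subvs mM))) (Ya0 (SimpleModule Msimple)).
  by rewrite /= rideal_opE // lfunE.
apply: rideal_module_simple => // U Uid UM; have [->|U0] := eqVneq U 0%VS; first by left.
have [->|UneM] := eqVneq U M; first by right.
have dimlt (V : {vspace A}) : (V <= M)%VS -> V != M -> (\dim V < n)%N.
  move=> VM VneM; apply: leq_trans Mn; rewrite ltn_neqAle dimvS // andbT.
  by apply: contra VneM => /eqP e; rewrite eqEdim VM e leqnn.
have [pi [piM piU pid]] := maschke U Uid.
(* [M] is the sum of [U] and [Q], both smaller than [M]: [m] is [m - pi m] in [Q] plus [pi m] in
   [U]. *)
pose Q := (M :&: lker pi)%VS.
have QM : (Q <= M)%VS by apply: capvSl.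
have [] := negP ma0; rewrite -[m](subrK (pi m)) mulrDl.
have -> : pi m * a = 0.
  by apply: (IHn U) => //; apply: dimlt.
rewrite addr0; apply/eqP; apply: (IHn Q) => //.
- apply: dimlt => //; apply: contra U0 => /eqP QeM.
  rewrite -subv0; apply/subvP => u uU; rewrite memv0.
  have : u \in Q by rewrite QeM (subvP UM).
  by rewrite memv_cap memv_ker pid // => /andP[].
- move=> b c; rewrite !memv_cap !memv_ker piM => /andP[bM /eqP ->].
  by rewrite mul0r eqxx Mid.
- rewrite memv_cap memv_ker linearB /= (pid (pi m)) // subrr eqxx andbT.
  by apply: memvB => //; apply: (subvP UM).
Qed.

End RightIdeals.

(** * The density theorem *)

Lemma linear_lfun (K : fieldType) (U V : vectType K) (f : U -> V) :
  linear f -> exists g : 'Hom(U, V), forall u, g u = f u.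
Proof.
move=> fL; pose g : {linear U -> V} := HB.pack f (GRing.isLinear.Build _ _ _ _ f fL).
by exists (linfun g) => u; rewrite lfunE.
Qed.

Section Density.

Variables (K : fieldType) (A : falgType K).

(** Density for several simple modules at once, repetitions allowed; the hypothesis excludes
    relations between the vectors [v p] through module homomorphisms. Induct on the set of
    prescribed indices: the elements that kill the earlier vectors move [v q] through a submodule of
    [Y q]. If it is all of [Y q], the value at [q] can be corrected; if it is 0, then [v q] depends
    on the earlier vectors. *)
Lemma jacobson_density (I : finType) (Y : I -> simple_module A) (v : forall p, Y p) :
  (forall q (phi : forall p, 'Hom(Y p, Y q)),
    (forall p a, phi p \o rmod_op (Y p) a = rmod_op (Y q) a \o phi p)%VF ->
    \sum_p phi p (v p) = 0 -> forall p, phi p = 0) ->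
  forall w : forall p, Y p, exists a, forall p, rmod_op (Y p) a (v p) = w p.
Proof.
move=> indep.
have opM p a b y : rmod_op (Y p) (a * b) y = rmod_op (Y p) b (rmod_op (Y p) a y).
  by rewrite rmod_opM comp_lfunE.
suff H n (S : {set I}) : (#|S| <= n)%N -> forall w : forall p, Y p,
    exists a, forall p, p \in S -> rmod_op (Y p) a (v p) = w p.
  by move=> w; have [a aP] := H #|I| setT (max_card _) w; exists a => p; apply: aP.
elim: n => [|n IHn] in S *.
  by rewrite leqn0 cards_eq0 => /eqP -> w; exists 0 => p; rewrite inE.
have [->|[q qS]] := set_0Vmem S; first by move=> _ w; exists 0 => p; rewrite inE.
rewrite (cardsD1 q) qS ltnS => /IHn {}IHn w.
set S' := S :\ q in IHn; have [a0 a0P] := IHn w.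
pose ev p a := rmod_op (Y p) a (v p).
have evL p : linear (ev p).
  by move=> c a b; rewrite /ev linearP add_lfunE scale_lfunE.
have [evl evlE] := fin_all_exists (fun p => linear_lfun (evL p)).
pose Ann := (\bigcap_(p in S') lker (evl p))%VS.
have AnnP a : reflect (forall p, p \in S' -> ev p a = 0) (a \in Ann).
  rewrite memvE; apply: (iffP subv_bigcapP) => h p pS.
    by rewrite -evlE; apply/eqP; rewrite -memv_ker memvE h.
  by rewrite -memvE memv_ker evlE h.
pose U := (evl q @: Ann)%VS.
have UP y : reflect (exists2 a, a \in Ann & y = ev q a) (y \in U).
  by apply: (iffP memv_imgP) => -[a aA ->]; exists a; rewrite ?evlE.
have [|U0|Ufull] := (smod_simple (Y q)).2 U.
- move=> a; apply/subvP => _ /memv_imgP [_ /UP [b /AnnP bA ->] ->].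
  apply/UP; exists (b * a); last by rewrite /ev opM.
  by apply/AnnP => p pS; rewrite /ev opM [rmod_op _ b _]bA // linear0.
(* Here the image of [v q] under [a] is determined by the images of the [v p] with [p] in [S'],
   which makes [v q] a sum of homomorphic images of these [v p]. *)
- have annq a : (forall p, p \in S' -> ev p a = 0) -> ev q a = 0.
    move=> aA; apply/eqP; rewrite -memv0 -U0; apply/UP; exists a => //.
    exact/AnnP.
  have single (p : I) (y : Y p) : exists a, forall p', p' \in S' ->
      ev p' a = dfwith (fun p => 0 : Y p) y p'.
    exact: IHn.
  have [c cP] := fin_all_exists (fun p =>
    fin_all_exists (fun i : 'I_(\dim {:Y p}) => single p ((vbasis {:Y p})`_i))).
  (* For [p] in [S'], this is an algebra element, linear in [y], that sends [v p] to [y] and kills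
     the other vectors indexed by [S']. *)
  pose sec p (y : Y p) := \sum_i coord (vbasis {:Y p}) i y *: c p i.
  have secL p : linear (@sec p).
    move=> k y z; rewrite /sec scaler_sumr -big_split /=.
    by apply: eq_bigr => i _; rewrite linearP scalerDl scalerA.
  have secP p (y : Y p) p' : p' \in S' ->
      ev p' (sec p y) = dfwith (fun p => 0 : Y p) y p'.
    move=> p'S; rewrite (linear_sumZ _ _ (evL _)).
    under eq_bigr do rewrite cP //.
    have [<-|pp'] := eqVneq p p'.
      under eq_bigr do rewrite dfwith_in.
      by rewrite dfwith_in -(coord_basis (vbasisP _) (memvf _)).
    rewrite dfwith_out // big1 // => i _.
    by rewrite dfwith_out // scaler0.
  have FL : forall p : I, linear (fun y => ev q (@sec p y)).
    by move=> p k y z; rewrite secL evL.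
  have [phi phiE] := fin_all_exists (fun p => linear_lfun (@FL p)).
  have evqE a : ev q a = \sum_(p in S') phi p (ev p a).
    under eq_bigr do rewrite phiE.
    under eq_bigr do rewrite -[ev q _]evlE.
    rewrite -linear_sum -[LHS]evlE; apply/eqP; rewrite -subr_eq0 -linearB [_ (_ - _)]evlE.
    apply/eqP/annq => p pS; rewrite -evlE linearB linear_sum /= (bigD1 p) //= big1.
      by rewrite addr0 !evlE secP // dfwith_in subrr.
    by move=> p' /andP[_ pp']; rewrite evlE secP // dfwith_out.
  have phiA p a (y : Y p) : p \in S' ->
      phi p (rmod_op (Y p) a y) = rmod_op (Y q) a (phi p y).
    move=> pS; rewrite [in RHS]phiE -opM -/(ev q _) evqE (bigD1 p) //= big1.
      by rewrite addr0 [ev p _]opM [rmod_op _ (sec p y) _]secP // dfwith_in.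
    move=> p' /andP[p'S pp']; rewrite [ev p' _]opM [rmod_op _ (sec p y) _]secP //.
    by rewrite dfwith_out 1?eq_sym // !linear0.
  pose phi0 p : 'Hom(Y p, Y q) := if p \in S' then phi p else 0.
  (* Putting -1 at [q] turns the dependence of [v q] on the [v p] into a relation, which the
     hypothesis forbids. *)
  pose psi := dfwith phi0 (- \1%VF : 'End(Y q)).
  have psiq : psi q = - \1%VF by rewrite /psi dfwith_in.
  have psiE p : p != q -> psi p = if p \in S' then phi p else 0.
    by move=> pq; rewrite /psi dfwith_out // eq_sym.
  have /(_ q) : forall p, psi p = 0.
    apply: indep => [p a|].
      have [->|pq] := eqVneq p q.
        by rewrite psiq comp_lfunNl comp_lfunNr comp_lfun1l comp_lfun1r.
      rewrite psiE //; case: ifP => pS; last by rewrite comp_lfun0l comp_lfun0r.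
      by apply/lfunP => y; rewrite !comp_lfunE phiA.
    rewrite (bigD1 q) //= psiq opp_lfunE id_lfunE; apply/eqP; rewrite addrC subr_eq0.
    have <- : ev q 1 = v q by rewrite /ev rmod_op1 id_lfunE.
    rewrite evqE [X in X == _](bigID (mem S')) /= [X in _ + X]big1 ?addr0; last first.
      by move=> p /andP[pq pS]; rewrite psiE // (negPf pS) lfunE.
    apply/eqP/eq_big => [p|p /andP[pq pS]].
      by rewrite !inE; case: eqP.
    by rewrite psiE // pS /ev rmod_op1 id_lfunE.
  rewrite psiq => /lfunP e; case: (smod_simple (Y q)).1.
  apply/vspaceP => y; rewrite memvf memv0; apply/esym.
  by have := e y; rewrite opp_lfunE id_lfunE lfunE => /eqP; rewrite oppr_eq0.
(* Adding [a1] corrects the value at [q] without disturbing those on [S']. *)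
- have /UP [a1 /AnnP a1P a1q] : w q - ev q a0 \in U by rewrite Ufull memvf.
  exists (a0 + a1) => p pS; rewrite -/(ev p _) -evlE linearD /= !evlE.
  have [->|pq] := eqVneq p q; first by rewrite -a1q addrC subrK.
  have pS' : p \in S' by rewrite !inE pq.
  by rewrite a1P // addr0 /ev a0P.
Qed.

End Density.

(** * Reduced traces *)

Section ReducedTrace.

Variables (K : fieldType) (D : falgType K).
Hypothesis D_field : GRing.field_axiom D.
Local Notation Z := (center_type D).

(** [D] is a left vector space over its center. Only spanning is recorded; freeness will follow from
    the splitting. Boolean equality and a finite function allow coordinates to be picked by
    [xchoose]. *)
Lemma center_basis : exists w : 'I_(\dim_('Z({:D})) {:D}) -> D,
  forall u, exists z : {ffun 'I_(\dim_('Z({:D})) {:D}) -> Z}, u == \sum_j vsval (z j) * w j.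
Proof.
have [X [sumX dX X0]] := skew_field_module_semisimple D_field (subvf ('Z({:D})%AS * {:D})).
have -> : \dim_('Z({:D})) {:D} = size X.
  have -> : \dim {:D} = (\dim 'Z({:D})%AS * size X)%N.
    rewrite -[in LHS]sumX (directvP dX) /=.
    rewrite (eq_big_seq (fun=> \dim 'Z({:D})%AS)) => [|x xX]; last first.
      by rewrite dim_cosetv_unit // D_field //; apply: contraNneq X0 => <-.
    by rewrite big_const_seq count_predT iter_addn_0.
  by rewrite mulKn // adim_gt0.
exists (fun j => X`_j) => u.
have : u \in (\sum_(x <- X) 'Z({:D}) * <[x]>)%VS by rewrite sumX memvf.
rewrite (big_nth 0) big_mkord => /memv_sumP [v vZ ->].
have vE j : exists z : Z, v j == vsval z * X`_j.
  have := vZ j isT; rewrite -limg_amulr => /memv_imgP [z zZ ->].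
  by exists (Subvs zZ); rewrite lfunE.
exists [ffun j => xchoose (vE j)]; apply/eqP/eq_bigr => j _.
by rewrite ffunE; apply/eqP/(xchooseP (vE j)).
Qed.

Lemma vsval_in_alg (a : K) : vsval (a%:A : Z) = a%:A.
Proof. by rewrite linearZ; congr (_ *: _); apply: (skew_field_algid1 D_field). Qed.

(** A nonzero central element is invertible in [D], so its image under [phi] cannot vanish. *)
Lemma center_embedding_inj (E : fieldType) (iota : {rmorphism Z -> E}) m
    (phi : {rmorphism D -> 'M[E]_m.+1}) :
  (forall z, phi (vsval z) = (iota z)%:M) -> injective iota.
Proof.
move=> phiZ; apply: raddf_inj => z z0; apply/eqP; have [//|zn0] := eqVneq z 0.
have /D_field zu : vsval z != 0.
  by apply: contra zn0 => /eqP e; apply/eqP/subvs_inj; rewrite e linear0.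
have := congr1 phi (divrr zu); rewrite rmorphM phiZ z0 rmorph1.
rewrite (_ : 0%:M = 0) ?mul0r; last exact: raddf0.
by move=> /eqP; rewrite eq_sym oner_eq0.
Qed.

Variable trd : D -> Z.
Hypothesis trd_red : reduced_trace trd.

Lemma reduced_trace_sum (I : finType) (u : I -> D) : trd (\sum_i u i) = \sum_i trd (u i).
Proof.
have [E [iota [m [phi [phiZ _ _ phi_tr]]]]] := trd_red.
apply: (center_embedding_inj phiZ); rewrite rmorph_sum -phi_tr !raddf_sum /=.
by apply: eq_bigr => i _; rewrite phi_tr.
Qed.

(** The last identity gives the trace over the center of u |-> m u n. After splitting it may be
    computed on matrix units: the (i, j) entry of M E_ij N is M_ii N_jj, and these sum to tr M tr
    N. *)
Lemma reduced_trace_coord : exists (J : nat) (w : 'I_J -> D) (c : 'I_J -> D -> Z),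
  [/\ forall j, linear (c j), forall j z u, c j (vsval z * u) = z * c j u,
      forall u, u = \sum_j vsval (c j u) * w j &
      forall m n, \sum_j c j (m * w j * n) = trd m * trd n].
Proof.
have [E [iota [m [phi [phiZ mD phi_span phi_tr]]]]] := trd_red.
have [w wP] := center_basis; rewrite -mD in w wP.
pose c j u := xchoose (wP u) j.
have cP u : u = \sum_j vsval (c j u) * w j by apply/eqP/(xchooseP (wP u)).
pose B := [tuple phi (w j) | j < m.+1 ^ 2].
have BE (j : 'I_(m.+1 ^ 2)) : B`_j = phi (w j) by rewrite -tnth_nth tnth_mktuple.
have phiE u : phi u = \sum_j iota (c j u) *: B`_j.
  rewrite {1}[u]cP rmorph_sum; apply: eq_bigr => j _.
  by rewrite rmorphM phiZ BE -mulmxE mul_scalar_mx.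
(* The family spans and has as many members as the dimension of the matrix algebra. Its freeness is
   what makes the [c j] linear over the center. *)
have B_basis : basis_of fullv B.
  rewrite basisEdim size_tuple dimvf [dim _]/=.
  have -> : (m.+1 ^ 2 <= m.+1 * m.+1)%N by rewrite mulnn.
  rewrite andbT.
  apply/subvP => M _; have [s ->] := phi_span M.
  apply: memv_suml => p _; apply: memvZ; rewrite phiE.
  apply: memv_suml => j _; apply: memvZ; apply: memv_span.
  by apply: mem_nth; rewrite size_tuple.
have iotac j u : iota (c j u) = coord B j (phi u).
  by rewrite phiE coord_sum_free // (basis_free B_basis).
have iota_inj := center_embedding_inj phiZ.
have phiZm z u : phi (vsval z * u) = iota z *: phi u.
  by rewrite rmorphM phiZ -mulmxE mul_scalar_mx.
exists (m.+1 ^ 2)%N, w, c; split=> // [j a u v|j z u|M N].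
- apply: iota_inj; rewrite -[a *: c j u]mulr_algl rmorphD rmorphM /= !iotac.
  have -> : a *: u = vsval (a%:A : Z) * u.
    by rewrite vsval_in_alg mulr_algl.
  by rewrite [phi (_ + _)]rmorphD phiZm linearP.
- by apply: iota_inj; rewrite rmorphM /= !iotac phiZm linearZ.
apply: iota_inj; rewrite rmorph_sum rmorphM /= -!phi_tr.
under eq_bigr => j _ do rewrite iotac !rmorphM /= -BE.
have sysB : dual_system (fun j : 'I_(m.+1 ^ 2) => B`_j) (coord B).
  split=> [j a u v|u]; first by rewrite linearP.
  exact: (coord_basis B_basis (memvf _)).
have sysE : dual_system (fun p : 'I_m.+1 * 'I_m.+1 => delta_mx p.1 p.2 : 'M[E]_m.+1)
    (fun p (M : 'M_m.+1) => M p.1 p.2).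
  split=> [p a u v|u]; first by rewrite !mxE.
  by rewrite {1}[u]matrix_sum_delta pair_bigA.
have L : linear (fun u : 'M[E]_m.+1 => phi M * u * phi N).
  by move=> a u v; rewrite mulrDr mulrDl -scalerAr -scalerAl.
rewrite (trace_dual_system sysB sysE L) /mxtrace big_distrlr /= pair_bigA /=.
apply: eq_bigr => -[i j] _ /=.
rewrite mxE (bigD1 j) //= big1 => [|l /negPf lj].
  rewrite addr0 mxE (bigD1 i) //= big1 ?addr0 => [|l /negPf li].
    by rewrite mxE !eqxx mulr1.
  by rewrite mxE li mulr0.
by rewrite mxE big1 ?mul0r // => l' _; rewrite mxE lj andbF mulr0.
Qed.

(** Transitivity of the trace: coordinates over the center are composed with coordinates of the
    center over [K]. *)
Lemma reduced_trace_dual_system : exists (I : finType) (u : I -> D) (f : I -> D -> K),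
  dual_system u f /\
  forall m n, \sum_i f i (m * u i * n) = field_trace (trd m * trd n).
Proof.
have [J [w [c [cL cZ cE cT]]]] := reduced_trace_coord.
pose e := vbasis {:Z}.
exists ('I_(\dim {:Z}) * 'I_J)%type, (fun p : 'I__ * 'I_J => vsval e`_p.1 * w p.2),
  (fun p : 'I__ * 'I_J => fun u => coord e p.1 (c p.2 u)).
split=> [|m n].
  split=> [p a u v|u]; first by rewrite cL linearP.
  rewrite {1}[u]cE.
  rewrite -(pair_bigA _ (fun (i : 'I__) j => coord e i (c j u) *: (vsval e`_i * w j))) /=.
  rewrite exchange_big /=; apply: eq_bigr => j _.
  rewrite {1}[c j u](coord_basis (vbasisP _) (memvf _)) linear_sum mulr_suml.
  by apply: eq_bigr => i _; rewrite linearZ /= scalerAl.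
rewrite -(pair_bigA _ (fun (i : 'I__) j => coord e i (c j (m * (vsval e`_i * w j) * n)))) /=.
rewrite field_traceE; apply: eq_bigr => i _.
rewrite -cT mulr_sumr linear_sum; apply: eq_bigr => j _; congr (coord _ _ _).
rewrite -cZ; congr (c j _); rewrite !mulrA; congr (_ * _ * _).
(* The basis element of the center commutes with [m], so it can be pulled out on the left. *)
have /memv_capP [_ /centvP/(_ m)] := subvsP e`_i.
by move=> ->; rewrite ?memvf.
Qed.

End ReducedTrace.

(** * Composite fields *)

(** Induction on the size. Irreducibility is not decidable over an arbitrary field, hence the appeal
    to excluded middle. *)
Lemma irreducible_factor (F : fieldType) (p : {poly F}) : (1 < size p)%N ->
  exists2 q, irreducible_poly q & q %| p.
Proof.
move: {2}(size p) (leqnn (size p)) => n; elim: n => [|n IHn] in p *.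
  by rewrite leqn0 => /eqP ->.
move=> pn p1; have p0 : p != 0 by rewrite -size_poly_gt0 (ltn_trans _ p1).
have [[q [q1 qp nqp]]|nq] :=
    classic (exists q : {poly F}, [/\ size q != 1, q %| p & ~~ (q %= p)]).
  have [||r rirr rq] := IHn q.
  - rewrite -ltnS (leq_trans _ pn) // ltn_neqAle dvdp_leq // andbT.
    by apply: contra nqp => /eqP e; rewrite -dvdp_size_eqp // e.
  - by rewrite ltn_neqAle eq_sym q1 size_poly_gt0; apply: contraTneq qp => ->; rewrite dvd0p.
  by exists r => //; apply: dvdp_trans qp.
exists p => //; split=> // q q1 qp.
by apply/negPn/negP => nqp; apply: nq; exists q.
Qed.

(** By separability L = K(theta). An irreducible factor over [E] of the minimal polynomial of theta
    gets a root [z] in an extension [E'] of [E], and f(theta) |-> f(z) embeds L into [E']. *)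
Lemma compositum (K : fieldType) (L : fieldExtType K) (E : fieldType)
    (kappa : {rmorphism K -> E}) : separable 1%VS {:L} ->
  exists (E' : fieldType) (e : {rmorphism E -> E'}) (j : {rmorphism L -> E'}),
    forall a, j a%:A = e (kappa a).
Proof.
move=> sepL; set theta := separable_generator 1 {:L}.
have adj : <<1; theta>>%VS = fullv.
  by apply/esym/eq_adjoin_separable_generator; rewrite ?sub1v.
have /polyOver1P [p0 p0E] := minPolyOver 1 theta.
have genP y : exists f : {poly K}, (map_poly (in_alg L) f).[theta] == y.
  have /polyOver1P [f fE] := Fadjoin_polyOver 1 theta y; exists f.
  by rewrite -fE Fadjoin_poly_eq // adj memvf.
have p0dvd f : (map_poly (in_alg L) f).[theta] = 0 -> p0 %| f.
  move=> f0; rewrite -(dvdp_map (in_alg L)) -p0E minPoly_dvdp //.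
    by apply/polyOver1P; exists f.
  exact/rootP.
have [|q qirr qp0] := @irreducible_factor _ (map_poly kappa p0).
  by rewrite size_map_poly -(size_map_poly (in_alg L)) -p0E size_minPoly ltnS.
have [E' _ [z qz _]] := irredp_FAdjoin qirr.
pose mu : {rmorphism K -> E'} := in_alg E' \o kappa.
have p0z : root (map_poly mu p0) z.
  by rewrite map_poly_comp; apply: root_dvdp qz; rewrite dvdp_map.
(* The choice of a polynomial for [y] is harmless: two choices differ by a multiple of [p0], which
   vanishes at [z]. *)
pose j y := (map_poly mu (xchoose (genP y))).[z].
have jE f : j (map_poly (in_alg L) f).[theta] = (map_poly mu f).[z].
  apply/eqP; rewrite -subr_eq0 -hornerN -hornerD -rmorphB -/(root _ _).
  apply: root_dvdp p0z; rewrite dvdp_map; apply: p0dvd.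
  by rewrite rmorphB hornerD hornerN (eqP (xchooseP (genP _))) subrr.
have jB : zmod_morphism j.
  move=> x y; rewrite -(eqP (xchooseP (genP x))) -(eqP (xchooseP (genP y))).
  by rewrite -hornerN -hornerD -rmorphB !jE rmorphB hornerD hornerN.
have jM : monoid_morphism j.
  split=> [|x y].
    by have := jE 1; rewrite !rmorph1 !hornerC.
  rewrite -(eqP (xchooseP (genP x))) -(eqP (xchooseP (genP y))).
  by rewrite -hornerM -rmorphM !jE rmorphM hornerM.
pose jj : {rmorphism L -> E'} := HB.pack j
  (GRing.isZmodMorphism.Build _ _ j jB) (GRing.isMonoidMorphism.Build _ _ j jM).
exists E', (in_alg E'), jj => a /=.
by have := jE a%:P; rewrite !map_polyC !hornerC.
Qed.

(** [G] permutes the distinct conjugates of [y], so the product of the X - z over them has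
    coefficients in K. *)
Lemma field_action_separable (K : fieldType) (L : fieldExtType K)
  (G : finGroupType) (to : field_action L G) : separable 1%VS {:L}.
Proof.
apply/separableP => y _; apply/separable_elementP.
pose r := undup [seq to y s | s : G].
have rs s : perm_eq r [seq to z s | z <- r].
  have inj : injective (fact_map to s) by apply: fmorph_inj.
  apply: uniq_perm; rewrite ?(map_inj_uniq inj) ?undup_uniq // => z.
  rewrite mem_undup; apply/mapP/mapP => -[t tG ->].
    exists (to y (t * s^-1)%g); last by rewrite -factM mulgKV.
    by rewrite mem_undup map_f ?mem_enum.
  move: tG; rewrite mem_undup => /mapP [u _ ->].
  by exists (u * s)%g; rewrite ?mem_enum // factM.
set P := \prod_(z <- r) ('X - z%:P).
have PE s : map_poly (fact_map to s) P = P.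
  rewrite rmorph_prod [RHS](perm_big _ (rs s)) big_map.
  by apply: eq_bigr => z _; rewrite rmorphB /= map_polyX map_polyC.
exists P; split.
- apply/polyOverP => i; have /fact_fixed [a ->] : forall s, to P`_i s = P`_i.
    by move=> s; rewrite -[LHS](coef_map (fact_map to s)) /= PE.
  by rewrite memvZ ?mem1v.
- rewrite root_prod_XsubC mem_undup; apply/mapP; exists 1%g; rewrite ?mem_enum //.
  by rewrite fact1.
- by rewrite separable_prod_XsubC undup_uniq.
Qed.

(** * Representations of the twisted group ring *)

(** In a rank factorization P = C R, idempotency forces R C = 1, an identity matrix whose size is
    the rank. *)
Lemma mxtrace_idempotent (F : fieldType) n (P : 'M[F]_n) :
  P *m P = P -> \tr P = (\rank P)%:R.
Proof.
move=> PP; rewrite -{1}(mulmx_base P) mxtrace_mulC.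
suff -> : row_base P *m col_base P = 1%:M by rewrite mxtrace1.
apply: (row_full_inj (col_base_full P)); apply: (row_free_inj (row_base_free P)).
by rewrite mulmx1 mulmxA -mulmxA !mulmx_base.
Qed.

Lemma mxrank_orthogonal_idempotents (F : fieldType) n (I : finType) (P : I -> 'M[F]_n) :
  (forall i j, P i *m P j = (i == j)%:R *: P i) -> \sum_i P i = 1%:M ->
  (\sum_i \rank (P i))%N = n.
Proof.
move=> PP P1; have /mxdirectP /= <- : mxdirect (\sum_i P i).
  apply/mxdirect_sumsP => i _; apply/eqP; rewrite -submx0.
  apply/row_subP => k; set u := row k _.
  have : (u <= P i :&: \sum_(j | j != i) P j)%MS by apply: row_sub.
  rewrite sub_capmx => /andP[/submxP [w uw] /sub_sumsmxP [v uv]].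
  have uP : u *m P i = u by rewrite uw -mulmxA PP eqxx scale1r.
  rewrite -uP uv mulmx_suml big1 ?sub0mx // => j /negPf ji.
  by rewrite -mulmxA PP ji scale0r mulmx0.
apply/eqP; rewrite -[_ == _]/(row_full _) -sub1mx -P1.
by apply: summx_sub => i _; apply: (sumsmx_sup i).
Qed.

Section Representation.

Variables (K : fieldType) (L : fieldExtType K) (G : finGroupType).
Variable to : field_action L G.
Hypothesis n_unit : (#|action_kernel to|%:R : K) != 0.
Local Notation A := (twisted_group_ring to).
Local Notation T := (galois_trace to).

Lemma tgr_elt_zmod_morphism s : zmod_morphism (tgr_elt to s).
Proof. by move=> y z; apply/ffunP => t; rewrite !ffunE; case: eqP; rewrite ?subr0. Qed.

Lemma tgr_elt_scalable s : scalable (tgr_elt to s).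
Proof. by move=> a y; apply/ffunP => t; rewrite !ffunE; case: eqP; rewrite ?scaler0. Qed.

HB.instance Definition _ s :=
  GRing.isZmodMorphism.Build L A (tgr_elt to s) (tgr_elt_zmod_morphism s).
HB.instance Definition _ s :=
  GRing.isScalable.Build K L A *:%R (tgr_elt to s) (tgr_elt_scalable s).

Lemma tgr_elt1 : tgr_elt to 1%g 1 = 1. Proof. by []. Qed.

Variables (E : fieldType) (j : {rmorphism L -> E}) (q : nat) (rho : A -> 'M[E]_q).
Hypothesis rhoB : zmod_morphism rho.
Hypothesis rho1 : rho 1 = 1%:M.
Hypothesis rhoM : forall a b, rho (a * b) = rho a *m rho b.
Hypothesis rhoZ : forall a : K, rho a%:A = (j a%:A)%:M.

(** Over [E], the algebra L is diagonalized: y acts as \sum_c y^c eta_c with orthogonal idempotents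
    eta_c of sum 1. Conjugation by group elements permutes them transitively, so they share a rank
    r; this yields both q = h r and the trace r \sum_c y^c. *)
Lemma tgr_rep_trace : exists r, q = (\dim {:L} * r)%N /\
  forall y, \tr (rho (tgr_elt to 1%g y)) = r%:R * j (T y)%:A.
Proof.
pose rhoL := GRing.isZmodMorphism.Build _ _ rho rhoB.
pose rho' : {additive A -> 'M[E]_q} := HB.pack rho rhoL.
pose el y := rho (tgr_elt to 1%g y).
have elZ (a : K) y : el (a *: y) = j a%:A *: el y.
  by rewrite /el linearZ -[X in rho X]mulr_algl rhoM rhoZ mul_scalar_mx.
have el_sum (I : finType) (f : I -> L) : el (\sum_i f i) = \sum_i el (f i).
  by rewrite /el raddf_sum; apply: (raddf_sum rho').
have [v' [_ v'sys _ v'rep]] := galois_dual_basis n_unit.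
set e := vbasis _ in v'sys v'rep.
(* The [eta c] are the projections onto the joint eigenspaces of [rho] on [L]. *)
pose eta (c : 'I_(galois_index to)) :=
  \sum_(k < \dim {:L}) j (to e`_k (galois_rep c)) *: el (v' k).
have elE y : el y = \sum_c j (to y (galois_rep c)) *: eta c.
  rewrite [in LHS](v'sys.2 y) el_sum.
  under [RHS]eq_bigr do rewrite scaler_sumr.
  rewrite exchange_big /=; apply: eq_bigr => k _.
  rewrite elZ (galois_trace_rep n_unit) rmorph_sum scaler_suml.
  by apply: eq_bigr => c _; rewrite scalerA factrM rmorphM.
have elM y z : el (y * z) = el y *m el z.
  by rewrite /el /= -rhoM tgr_eltM mulg1 fact1.
have jdelta (c d : 'I_(galois_index to)) :
    \sum_k j (to (v' k) (galois_rep c)) * j (to e`_k (galois_rep d)) = (c == d)%:R.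
  rewrite -[RHS](rmorph_nat j) -v'rep rmorph_sum.
  by apply: eq_bigr => k _; rewrite rmorphM.
have etaM c d : eta c *m eta d = (c == d)%:R *: eta c.
  transitivity (\sum_b ((b == c)%:R * (b == d)%:R) *: eta b).
    under [RHS]eq_bigr do rewrite -!jdelta big_distrlr scaler_suml.
    rewrite exchange_big mulmx_suml; apply: eq_bigr => k _ /=.
    under [RHS]eq_bigr do rewrite scaler_suml.
    rewrite exchange_big mulmx_sumr; apply: eq_bigr => l _ /=.
    rewrite -scalemxAl -scalemxAr -elM elE !scaler_sumr; apply: eq_bigr => b _.
    rewrite !scalerA factrM rmorphM; congr (_ *: _).
    by rewrite mulrACA; congr (_ * _); apply: mulrC.
  rewrite (bigD1 c) //= eqxx mul1r big1 ?addr0 // => b /negPf ->.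
  by rewrite mul0r scale0r.
have eta_sum : \sum_c eta c = 1%:M.
  rewrite -rho1 -tgr_elt1 -[rho _]/(el 1) elE.
  by apply: eq_bigr => c _; rewrite factr1 rmorph1 scale1r.
have eta_conj c d : exists2 M, M \in unitmx & M *m eta c = eta d *m M.
  (* Chosen so that (y^s)^c = y^d; conjugation by s then carries one projection to the other. *)
  pose s := (galois_rep d * (galois_rep c)^-1)%g.
  pose M := rho (tgr_elt to s 1).
  have MV : M *m rho (tgr_elt to s^-1%g 1) = 1%:M.
    by rewrite -rhoM tgr_eltM mulgV factr1 mul1r rho1.
  exists M; first by case/mulmx1_unit: MV.
  have ME y : el y *m M = M *m el (to y s).
    rewrite /el /M /= -!rhoM !tgr_eltM mul1g mulg1 mulr1 factr1 mul1r.
    by [].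
  rewrite mulmx_suml; under eq_bigr do rewrite -scalemxAl ME scalemxAr.
  rewrite -mulmx_sumr; congr (_ *m _).
  under eq_bigr do rewrite elE scaler_sumr.
  rewrite exchange_big /= (bigD1 c) //= [X in _ + X]big1 => [|b bc].
    rewrite addr0; under eq_bigr do rewrite scalerA.
    rewrite -scaler_suml -[LHS]scale1r; congr (_ *: _).
    transitivity ((d == d)%:R : E); first by rewrite eqxx.
    rewrite -jdelta; apply: eq_bigr => k _.
    by rewrite -factM /s mulgKV mulrC.
  under eq_bigr do rewrite scalerA.
  have [b' b'E] := galois_rep_onto to (s * galois_rep b)%g.
  rewrite -scaler_suml -[RHS](scale0r (eta b)); congr (_ *: _).
  transitivity ((b' == d)%:R : E).
    rewrite -jdelta; apply: eq_bigr => k _.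
    by rewrite -factM b'E mulrC.
  case: eqP => // b'd; case/eqP: bc; apply: galois_rep_inj => y.
  have := b'E (to y s^-1%g); rewrite -factM mulKg => ->.
  by rewrite b'd -factM /s invMg invgK mulgKV.
have [c0 _] := galois_rep_onto to 1%g.
have rank_eta c : \rank (eta c) = \rank (eta c0).
  have [M Mu ME] := eta_conj c c0.
  rewrite -(mxrankMfree (eta c0) (_ : row_free M)) ?row_free_unit // -ME.
  by rewrite -[RHS]mxrank_tr trmx_mul mxrankMfree ?mxrank_tr // row_free_unit unitmx_tr.
exists (\rank (eta c0)); split=> [|y].
  rewrite -[LHS](mxrank_orthogonal_idempotents etaM eta_sum).
  under eq_bigr do rewrite rank_eta.
  by rewrite sum_nat_const card_ord (galois_index_dim n_unit).
rewrite -[rho _]/(el y) elE linear_sum (galois_trace_rep n_unit) rmorph_sum mulr_sumr.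
apply: eq_bigr => c _; rewrite linearZ /= mxtrace_idempotent ?rank_eta 1?mulrC //.
by rewrite etaM eqxx scale1r.
Qed.

End Representation.

(** * The symmetrizing form *)

Section Symmetrizing.

Variables (K : fieldType) (L : fieldExtType K) (G : finGroupType).
Variable to : field_action L G.
Hypothesis n_unit : (#|action_kernel to|%:R : K) != 0.
Local Notation A := (twisted_group_ring to).
Local Notation T := (galois_trace to).
Local Notation h := (\dim {:L}).
Local Notation TL := (galois_trace_scalar to).

Definition tgr_trace (a : A) : K := T (a 1%g).
Local Notation t := tgr_trace.

Lemma tgr_trace_scalar : scalar t.
Proof. by move=> c a b; rewrite /t !ffunE TL. Qed.

Lemma tgr_traceM (a b : A) : t (a * b) = \sum_s T (to (a s) s^-1%g * b s^-1%g).
Proof.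
rewrite /t ffunE (scalar_sum_of _ TL).
by apply: eq_bigr => s _; rewrite mulg1.
Qed.

Lemma tgr_formE (a b : A) : tgr_form a b = t (a * b).
Proof.
rewrite tgr_traceM; apply: eq_bigr => s _.
rewrite (bigD1 s^-1%g) //= invgK eqxx mul1r big1 ?addr0 => [|u /negPf us].
  exact: galois_trace_field_trace.
by rewrite -[s]invgK (inj_eq invg_inj) eq_sym us mul0r.
Qed.

Lemma tgr_traceC (a b : A) : t (a * b) = t (b * a).
Proof.
rewrite !tgr_traceM (reindex_inj invg_inj); apply: eq_bigr => s _ /=.
rewrite invgK -(galois_trace_fact to _ s^-1%g) factrM -factM mulgV fact1.
by rewrite mulrC.
Qed.

(** Testing against the elements s^-1 z isolates the coefficient of [a] at s. *)
Lemma tgr_trace_nondegenerate (a : A) : (forall b, t (a * b) = 0) -> a = 0.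
Proof.
move=> ta0; apply/ffunP => s; rewrite ffunE.
suff e : to (a s) s^-1%g = 0.
  by rewrite -[LHS](fact1 to) -(mulVg s) factM e factr0.
apply: (galois_trace_nondegenerate n_unit) => z.
rewrite -[RHS](ta0 (tgr_elt to s^-1%g z)) tgr_traceM (bigD1 s) //= ffunE eqxx.
rewrite big1 ?addr0 // => u /negPf us.
by rewrite ffunE (inj_eq invg_inj) us mulr0 -(scale0r (0 : L)) (scalarZ_of _ _ TL) mul0r.
Qed.

Section Averaging.

Variable x : L.
Hypothesis Tx : T x = #|action_kernel to|%:R^-1.

(** The left side is the trace of c |-> a c x. On the basis of the s e_i, the coefficient at s of a
    (s e_i) x is (a_1)^s e_i x. Summing over i gives Tr((a_1)^s x), and then over s gives n Tr(a_1)
    Tr(x). *)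
Lemma tgr_trace_mull_mulr (a : A) (I : finType) (u : I -> A) f : dual_system u f ->
  \sum_i f i (a * u i * tgr_elt to 1%g x) = t a.
Proof.
move=> uf; have [v' [v'sys _ v'1 _]] := galois_dual_basis n_unit.
set e := vbasis _ in v'sys v'1.
have sys : dual_system (fun p : G * 'I_h => tgr_elt to p.1 e`_p.2)
    (fun p a => T (v' p.2 * a p.1)).
  split=> [p c b b'|w].
    by rewrite !ffunE mulrDr -scalerAr TL.
  apply/ffunP => s; rewrite sum_ffunE -(pair_bigA _ (fun s' (i : 'I_h) =>
    (T (v' i * w s') *: tgr_elt to s' e`_i) s)) /=.
  rewrite (bigD1 s) //= [X in _ + X]big1 ?addr0 => [|s' /negPf ss'].
    rewrite {1}[w s]v'sys.2; apply: eq_bigr => i _.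
    by rewrite !ffunE eqxx.
  by apply: big1 => i _; rewrite !ffunE eq_sym ss' scaler0.
have lin : linear (fun u : A => a * u * tgr_elt to 1%g x).
  by move=> c b b'; rewrite mulrDr mulrDl -scalerAr -scalerAl.
rewrite (trace_dual_system uf sys lin).
rewrite -(pair_bigA _ (fun s (i : 'I_h) =>
  T (v' i * (a * tgr_elt to s e`_i * tgr_elt to 1%g x) s))) /=.
have coefE s i : (a * tgr_elt to s e`_i * tgr_elt to 1%g x) s = to (a 1%g) s * e`_i * x.
  rewrite ffunE (bigD1 s) //= mulVg big1 => [|s' /negPf ss'].
    rewrite fact1 !ffunE eqxx addr0 (bigD1 1%g) //= big1 => [|s' /negPf s1].
      by rewrite invg1 mul1g ffunE eqxx addr0.
    rewrite ffunE -[X in _ == X]mul1g (inj_eq (mulIg s)) -(inj_eq invg_inj).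
    by rewrite invgK invg1 s1 mulr0.
  by rewrite [tgr_elt _ _ _ _]ffunE -eq_mulVg1 ss' mulr0.
under eq_bigr => s _.
  under eq_bigr => i _ do rewrite coefE -mulrA [v' i * _]mulrCA [v' i * _]mulrA.
  rewrite -(scalar_sum_of _ TL) -mulr_sumr -mulr_suml v'1 mul1r.
  over.
rewrite -(scalar_sum_of _ TL) -mulr_suml (galois_trace_sum n_unit) mulr_algl.
by rewrite (scalarZ_of _ _ TL) Tx mulrAC mulfV // mul1r.
Qed.

(** A K-linear projection onto [U] is averaged over a pair of dual bases for t, with [x] inserted to
    normalize the average. *)
Lemma tgr_maschke (U : {vspace A}) : right_ideal U -> exists pi : 'End(A),
  [/\ forall b c, pi (b * c) = pi b * c, forall b, pi b \in U &
      forall b, b \in U -> pi b = b].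
Proof.
move=> Uid.
have tL a : scalar (fun b => t (a * b)).
  by move=> c b b'; rewrite mulrDr -scalerAr tgr_trace_scalar.
have tR b : scalar (fun a => t (a * b)).
  by move=> c a a'; rewrite mulrDl -scalerAl tgr_trace_scalar.
have [u' u'E] := dual_basis tL tR tgr_trace_nondegenerate.
set e := vbasis _ in u'E; pose ex := tgr_elt to 1%g x.
have sysE w : w = \sum_i t (w * u' i) *: e`_i.
  rewrite [LHS](coord_basis (vbasisP _) (memvf _)).
  by apply: eq_bigr => i _; rewrite u'E.
have sysE' w : w = \sum_(i < \dim {:A}) t (w * e`_i) *: u' i.
  apply/eqP; rewrite -subr_eq0; apply/eqP/tgr_trace_nondegenerate => z.
  rewrite -scaleN1r addrC tR mulN1r addrC; apply/eqP; rewrite subr_eq0.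
  rewrite {1}[z]sysE mulr_sumr mulr_suml !(scalar_sum_of _ tgr_trace_scalar).
  apply/eqP/eq_bigr => i _.
  rewrite -scalerAr -scalerAl !(scalarZ_of _ _ tgr_trace_scalar) mulrC.
  by rewrite [t (u' i * z)]tgr_traceC.
(* Applying t after multiplication by [b], the left side becomes the trace of c |-> b c ex, which is
   t(b) by [tgr_trace_mull_mulr]. *)
have casimir1 : \sum_(i < \dim {:A}) e`_i * ex * u' i = 1.
  apply/eqP; rewrite -subr_eq0; apply/eqP/tgr_trace_nondegenerate => b.
  rewrite -scaleN1r addrC tR mulN1r addrC; apply/eqP; rewrite subr_eq0 mul1r.
  rewrite -(tgr_trace_mull_mulr b (coord_dual_system A)) mulr_suml.
  rewrite (scalar_sum_of _ tgr_trace_scalar); apply/eqP/eq_bigr => i _.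
  by rewrite u'E -mulrA tgr_traceC !mulrA -!mulrA tgr_traceC !mulrA.
pose pi : 'End(A) :=
  (\sum_(i < \dim {:A}) (amulr (u' i) \o (projv U \o (amulr ex \o amulr e`_i))))%VF.
have piE b : pi b = \sum_(i < \dim {:A}) projv U (b * e`_i * ex) * u' i.
  by rewrite sum_lfunE; apply: eq_bigr => i _; rewrite !comp_lfunE !lfunE.
exists pi; split=> [b c|b|b bU].
(* The Casimir tensor \sum_i e_i (tensor) u'_i commutes with [c], as expanding both sides in the
   dual bases shows. *)
- rewrite !piE mulr_suml.
  under [RHS]eq_bigr => i _ do rewrite -[_ * u' i * c]mulrA [u' i * c]sysE' mulr_sumr.
  rewrite exchange_big /=; apply: eq_bigr => k _.
  rewrite -[b * c * _]mulrA {1}[c * e`_k]sysE mulr_sumr mulr_suml linear_sum mulr_suml.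
  apply: eq_bigr => i _.
  by rewrite -scalerAr -scalerAl linearZ -scalerAl -scalerAr [t (c * _ * _)]tgr_traceC mulrA.
- by rewrite piE; apply: memv_suml => i _; apply: Uid; apply: memv_proj.
rewrite piE -[RHS]mulr1 -casimir1 mulr_sumr; apply: eq_bigr => i _.
by rewrite projv_id ?mulrA // !Uid.
Qed.

End Averaging.

Lemma tgr_semisimple (a : A) : (forall Y : simple_module A, rmod_op Y a = 0) -> a = 0.
Proof.
have [x Tx] := galois_trace_surj n_unit.
exact: (semisimple_annihilator (tgr_maschke Tx)).
Qed.

End Symmetrizing.

(** * Simple modules *)

Section SimpleModules.

Variables (K : fieldType) (A : falgType K).

Lemma schur (X Y : simple_module A) (f : 'Hom(X, Y)) :
  (forall a, f \o rmod_op X a = rmod_op Y a \o f)%VF -> f = 0 \/ bijective f.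
Proof.
move=> fA; have fAE a v : f (rmod_op X a v) = rmod_op Y a (f v).
  by have /lfunP/(_ v) := fA a; rewrite !comp_lfunE.
have [|ker0|kerf] := (smod_simple X).2 (lker f); last 1 first.
- by left; apply/lfunP => v; rewrite lfunE; apply/eqP; rewrite -memv_ker kerf memvf.
- move=> a; apply/subvP => _ /memv_imgP [v vk ->].
  by move: vk; rewrite !memv_ker fAE => /eqP ->; rewrite linear0.
have f_inj : injective f by apply/lker0P/eqP.
have [|im0|imf] := (smod_simple Y).2 (limg f).
- move=> a; apply/subvP => _ /memv_imgP [_ /memv_imgP [v _ ->] ->].
  by rewrite -fAE memv_img ?memvf.
- left; apply/lfunP => v; rewrite lfunE; apply/eqP.
  by rewrite -memv0 -im0 memv_img ?memvf.
right; exists (f^-1)%VF => v; first by rewrite lker0_lfunK // ker0.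
by rewrite limg_lfunVK // imf memvf.
Qed.

Lemma rmod_iso_refl (X : right_module A) : rmod_iso X X.
Proof.
exists \1%VF => [|a]; last by rewrite comp_lfun1l comp_lfun1r.
by exists id => v; rewrite id_lfunE.
Qed.

(** By Schur there are no zero divisors, which in finite dimension suffices for inverses. *)
Lemma endo_field (X : simple_module A) : GRing.field_axiom (endo X).
Proof.
apply: Falgebra_FieldMixin => f g fg0.
have /rmod_commP/schur [f0|[f' f'K _]] := subvsP f.
  by apply/orP; left; apply/eqP/subvs_inj; rewrite f0 linear0.
apply/orP; right; apply/eqP/subvs_inj/lfunP => v; apply: (can_inj f'K).
have := congr1 (fun u : endo X => endo_app u v) fg0.
rewrite endo_mulE /endo_app linear0 => ->.
by rewrite lfunE /= linear0.
Qed.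

Section Omega.

Variables (X : simple_module A) (x : nat) (b : endo_basis X x).

Lemma endo_app_linearl v : linear (fun f : endo X => endo_app f v).
Proof. by move=> c f g; rewrite /endo_app linearP add_lfunE scale_lfunE. Qed.

Lemma endo_app_linearr f : linear (endo_app f : X -> X).
Proof. by move=> c v w; rewrite /endo_app linearP. Qed.

Lemma endo_app_op f a v : endo_app f (rmod_op X a v) = rmod_op X a (endo_app f v).
Proof.
have /rmod_commP/(_ a)/lfunP/(_ v) := subvsP f.
by rewrite !comp_lfunE.
Qed.

Lemma ecoord0 : ecoord b 0 = 0.
Proof.
rewrite -[RHS](ecombK b); congr (ecoord b _).
by rewrite big1 // => j _; rewrite mxE /endo_app linear0 lfunE.
Qed.

Lemma omegaE a j : rmod_op X a (b j) = \sum_l endo_app (omega b a j l) (b l).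
Proof.
rewrite -[LHS](ecoordK b); apply: eq_bigr => l _.
by rewrite mxE.
Qed.

Lemma omega_eq a (M : 'M[endo X]_x) :
  (forall j, rmod_op X a (b j) = \sum_l endo_app (M j l) (b l)) -> omega b a = M.
Proof.
move=> aM; apply/row_matrixP => j; apply/rowP => l.
rewrite -(ecombK b (row j M)) !mxE aM.
by congr (ecoord b _ 0 l); apply: eq_bigr => k _; rewrite mxE.
Qed.

Lemma omega_linear j l : linear (fun a => omega b a j l).
Proof.
move=> c a a'.
rewrite (@omega_eq _ (\matrix_(j, l) (c *: omega b a j l + omega b a' j l))) ?mxE //.
move=> j'; rewrite linearP add_lfunE scale_lfunE !omegaE.
rewrite scaler_sumr -big_split /=; apply: eq_bigr => l' _.
by rewrite mxE endo_app_linearl.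
Qed.

Lemma omega1 : omega b 1 = 1%:M.
Proof.
apply: omega_eq => j; rewrite rmod_op1 id_lfunE (bigD1 j) //= big1 => [|l /negPf lj].
  by rewrite mxE eqxx /endo_app lfunE addr0.
by rewrite mxE eq_sym lj /endo_app linear0 lfunE.
Qed.

(** Scalars act on the left and commute with the module operation, so on rows the order of products
    is preserved. *)
Lemma omegaM a a' : omega b (a * a') = omega b a *m omega b a'.
Proof.
apply: omega_eq => j; rewrite rmod_opM comp_lfunE omegaE linear_sum /=.
under eq_bigr => l _.
  rewrite -endo_app_op omegaE.
  rewrite -[\sum_l _](_ :
    \sum_l0 (1 : K) *: endo_app (omega b a' l l0) (b l0) = _); last first.
    by apply: eq_bigr => l0 _; rewrite scale1r.
  rewrite (linear_sumZ _ _ (endo_app_linearr _)).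
  under eq_bigr do rewrite scale1r -endo_mulE.
  over.
rewrite exchange_big /=; apply: eq_bigr => l _.
rewrite mxE; set F := fun _ => _.
have := linear_sumZ (fun=> 1) (fun i => omega b a j i * omega b a' i l)
  (endo_app_linearl (b l)).
under eq_bigr do rewrite scale1r.
by move=> ->; apply: eq_bigr => i _; rewrite scale1r.
Qed.

Lemma omega_eq0 a : omega b a = 0 -> rmod_op X a = 0.
Proof.
move=> a0; apply/lfunP => v; rewrite -(ecoordK b v) lfunE linear_sum big1 // => j _.
rewrite /= -endo_app_op omegaE a0 big1 => [|l _].
  by rewrite /endo_app linear0.
by rewrite mxE /endo_app linear0 lfunE.
Qed.

End Omega.

(** Density for all basis vectors of all the [X i]. By Schur, a relation with values in [X i]
    involves only the basis vectors of [X i], with coefficients in [endo (X i)], hence is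
    trivial. *)
Lemma omega_surj (k : nat) (X : 'I_k -> simple_module A)
    (X_inj : forall i j, rmod_iso (X i) (X j) -> i = j)
    (x : 'I_k -> nat) (b : forall i, endo_basis (X i) (x i))
    (M : forall i, 'M[endo (X i)]_(x i)) :
  exists a, forall i, omega (b i) a = M i.
Proof.
pose I := {i : 'I_k & 'I_(x i)}.
pose v (p : I) : X (tag p) := b (tag p) (tagged p).
pose w (p : I) : X (tag p) := \sum_l endo_app (M (tag p) (tagged p) l) (b (tag p) l).
have [|a aP] := @jacobson_density _ _ I (fun p => X (tag p)) v _ w; last first.
  by exists a => i; apply: omega_eq => j; apply: (aP (Tagged _ j)).
move=> q phi phiA phi0 p.
have noniso (p' : I) : tag p' != tag q -> phi p' = 0.
  move=> pq; have [//|bij] := schur (phiA p').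
  by case/eqP: pq; apply: X_inj; exists (phi p').
have [|pq] := eqVneq (tag p) (tag q); last exact: noniso.
clear w M.
(* Only the index of the target module matters; it is generalized so that the equality of indices
   can be substituted in the types. *)
move: (tag q) phi phiA phi0 noniso => i phi phiA phi0 noniso {q}.
case: p => i' l /= e; subst i'.
pose f l : endo (X i) := Subvs (introT (rmod_commP _) (phiA (Tagged _ l))).
have f0 : \sum_l endo_app ((\row_l f l) 0 l) (b i l) = 0.
  rewrite -[RHS]phi0 sum_sig.
  rewrite (bigD1 i) //= [X in _ + X]big1 => [|i' ii'].
    by rewrite addr0; apply: eq_bigr => l' _; rewrite mxE.
  by apply: big1 => l' _; rewrite noniso ?lfunE.
have := ecombK (b i) (\row_l f l); rewrite f0.
rewrite ecoord0 => /rowP/(_ l); rewrite !mxE => /(congr1 (@vsval _ _ _)) /=.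
by move=> <-.
Qed.

End SimpleModules.

(** * The Plancherel formula *)

Section Plancherel.

Variables (K : fieldType) (L : fieldExtType K) (G : finGroupType).
Variable to : field_action L G.
Hypothesis n_unit : (#|action_kernel to|%:R : K) != 0.
Local Notation A := (twisted_group_ring to).
Local Notation T := (galois_trace to).

(** Splitting each entry of [omega] into a block of size d through [phi] gives a representation of
    size x d. Once the splitting field is enlarged to contain L, [tgr_rep_trace] applies; it also
    shows that the division by h is exact. *)
Lemma reduced_trace_omega (X : simple_module A) (x d : nat) (b : endo_basis X x)
    (trd : endo X -> center_type (endo X)) :
  (d ^ 2)%N = \dim_('Z({:endo X})) {:endo X} -> reduced_trace trd ->
  forall y, trd (\tr (omega b (tgr_elt to 1%g y))) = ((x * d %/ \dim {:L})%:R * T y)%:A.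
Proof.
move=> dE trd_red y; have [E [iota [m [phi [phiZ mE _ phi_tr]]]]] := trd_red.
have {dE mE} -> : d = m.+1 by apply/eqP; rewrite -(@eqn_exp2r _ _ 2) // dE mE.
pose kappa : {rmorphism K -> E} := iota \o in_alg (center_type (endo X)).
have [E' [e [j jE]]] := compositum kappa (field_action_separable to).
pose I := ('I_x * 'I_m.+1)%type.
pose rho (a : A) : 'M[E']_#|{: I}| := \matrix_(u, v)
  e (phi (omega b a (enum_val u).1 (enum_val v).1) (enum_val u).2 (enum_val v).2).
have rhoE a u v : rho a u v =
    e (phi (omega b a (enum_val u).1 (enum_val v).1) (enum_val u).2 (enum_val v).2).
  by rewrite mxE.
have phi_scal (c : K) : phi c%:A = (kappa c)%:M.
  by rewrite -phiZ (vsval_in_alg (@endo_field _ _ X)).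
have rhoB : zmod_morphism rho.
  move=> a a'; apply/matrixP => u v.
  rewrite rhoE [RHS]mxE [(- rho a') u v]mxE !rhoE -rmorphB; congr (e _).
  by rewrite (linearB_of _ _ (omega_linear b _ _)) rmorphB !mxE.
have rhoZ (c : K) : rho c%:A = (j c%:A)%:M.
  apply/matrixP => u v; rewrite rhoE [RHS]mxE jE.
  have -> : omega b c%:A (enum_val u).1 (enum_val v).1 =
      ((enum_val u).1 == (enum_val v).1)%:R * c%:A.
    rewrite (linearZ_of _ _ (omega_linear b _ _)) omega1 mxE.
    by rewrite mulr_natl scalerMnr.
  rewrite rmorphM rmorph_nat phi_scal mulr_natl -raddfMn /= mxE.
  rewrite -(inj_eq enum_val_inj) -pair_eqE /pair_eq.
  by case: eqP; case: eqP; rewrite ?mulr0n ?mulr1n ?rmorph0.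
have rho1 : rho 1 = 1%:M by rewrite -[1]scale1r rhoZ scale1r rmorph1.
have rhoM a a' : rho (a * a') = rho a *m rho a'.
  apply/matrixP => u v; rewrite rhoE [RHS]mxE omegaM mxE rmorph_sum summxE rmorph_sum.
  rewrite (reindex (@enum_rank I)) /=; last by apply/onW_bij/enum_rank_bij.
  transitivity (\sum_l \sum_r
      rho a u (enum_rank ((l, r) : I)) * rho a' (enum_rank ((l, r) : I)) v); last first.
    by rewrite pair_bigA; apply: eq_bigr => -[].
  apply: eq_bigr => l _; rewrite rmorphM mxE rmorph_sum; apply: eq_bigr => r _.
  by rewrite !rhoE !enum_rankK rmorphM.
have [r [qE trE]] := tgr_rep_trace n_unit rhoB rho1 rhoM rhoZ.
have -> : (x * m.+1 %/ \dim {:L})%N = r.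
  move: qE; rewrite card_prod !card_ord => ->.
  by rewrite mulKn // -(galois_index_dim n_unit) galois_index_gt0.
apply: (center_embedding_inj (@endo_field _ _ X) phiZ); apply: (fmorph_inj e).
rewrite -phi_tr [iota _](_ : _ = kappa (r%:R * T y)) // -jE -scalerA scaler_nat rmorphMn /=.
rewrite -mulr_natl -trE /mxtrace rmorph_sum.
rewrite (reindex (@enum_rank I)) /=; last by apply/onW_bij/enum_rank_bij.
transitivity (\sum_l \sum_r
    rho (tgr_elt to 1%g y) (enum_rank ((l, r) : I)) (enum_rank (l, r))).
  rewrite [RHS]exchange_big /=; apply: eq_bigr => i _.
  rewrite [phi _]rmorph_sum summxE rmorph_sum; apply: eq_bigr => l _.
  by rewrite rhoE !enum_rankK.
by rewrite pair_bigA; apply: eq_bigr => -[].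
Qed.

End Plancherel.

Theorem proposition1p16 (K : fieldType) (L : fieldExtType K) (G : finGroupType)
    (to : field_action L G)
    (n_unit : (#|action_kernel to|%:R : K) != 0)
    (k : nat) (X : 'I_k -> simple_module (twisted_group_ring to))
    (X_repr : forall Y : simple_module (twisted_group_ring to),
      exists! i : 'I_k, rmod_iso Y (X i))
    (x : 'I_k -> nat) (b : forall i : 'I_k, endo_basis (X i) (x i))
    (d : 'I_k -> nat)
    (d_gt0 : forall i : 'I_k, (0 < d i)%N)
    (d_sqr : forall i : 'I_k,
      (d i ^ 2)%N = \dim_('Z({:endo (X i)})) {:endo (X i)})
    (trd : forall i : 'I_k, endo (X i) -> center_type (endo (X i)))
    (trd_red : forall i : 'I_k, reduced_trace (trd i))
    (xi eta : twisted_group_ring to) :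
  tgr_form xi eta =
    \sum_(i < k)
      (#|action_kernel to|%:R^-1 * (x i * d i %/ \dim {:L})%:R) *
      field_trace (trd i (\tr (omega (b i) xi *m omega (b i) eta))).
Proof.
rewrite (tgr_formE n_unit); under eq_bigr do rewrite -omegaM.
move: (xi * eta) => a {xi eta}.
have X_inj i j : rmod_iso (X i) (X j) -> i = j.
  have [i' [_ uniq_i]] := X_repr (X i) => /uniq_i <-.
  by apply/esym/uniq_i/rmod_iso_refl.
(* Every simple module is isomorphic to some [X i], so a difference killed by all [omega (b i)] acts
   as zero on every simple module. *)
have omega_inj a1 a2 : (forall i, omega (b i) a1 = omega (b i) a2) -> a1 = a2.
  move=> e12; apply/eqP; rewrite -subr_eq0; apply/eqP/(tgr_semisimple n_unit) => Y.
  have [i [[f [g fK gK] fA] _]] := X_repr Y.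
  have X0 : rmod_op (X i) (a1 - a2) = 0.
    apply: (omega_eq0 (b := b i)); apply/matrixP => r s.
    by rewrite (linearB_of _ _ (omega_linear (b i) r s)) e12 subrr mxE.
  apply/lfunP => v; apply: (can_inj fK); have /lfunP/(_ v) := fA (a1 - a2).
  by rewrite !comp_lfunE => ->; rewrite X0 !lfunE /= linear0.
have [y Ty] := galois_trace_surj n_unit.
pose ey := tgr_elt to 1%g y.
have [J JP] := fin_all_exists (fun i =>
  reduced_trace_dual_system (@endo_field _ _ (X i)) (trd_red i)).
have [u uP] := fin_all_exists JP.
have [f fP] := fin_all_exists uP.
pose I i := ('I_(x i) * 'I_(x i) * J i)%type.
(* These matrices are concentrated in one entry of one block, where they take a member of the dual
   system of the skew field; [U] lifts them to the twisted group ring. *)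
pose M (p : {i : 'I_k & I i}) : forall i, 'M[endo (X i)]_(x i) :=
  dfwith (fun i => 0 : 'M[endo (X i)]_(x i))
    (\matrix_(r, s) if (r, s) == (tagged p).1 then u (tag p) (tagged p).2 else 0).
have [U UE] := fin_all_exists (fun p => omega_surj X_inj b (M p)).
pose F (p : {i : 'I_k & I i}) (c : twisted_group_ring to) : K :=
  f (tag p) (tagged p).2 (omega (b (tag p)) c (tagged p).1.1 (tagged p).1.2).
have sysF : dual_system U F.
  split=> [p c a1 a2|w].
    by rewrite /F omega_linear (fP (tag p)).1.1.
  apply: omega_inj => i; apply/matrixP => r s.
  rewrite (linear_sumZ _ _ (omega_linear (b i) r s)) sum_sig (bigD1 i) //=.
  rewrite [X in _ + X]big1 ?addr0 => [|i' ii']; last first.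
    by apply: big1 => q _; rewrite UE /M dfwith_out // mxE scaler0.
  under eq_bigr => q _ do rewrite UE /M dfwith_in mxE /=.
  rewrite -(pair_bigA _ (fun q l => F (Tagged I (q, l)) w *:
    (if (r, s) == q then u i l else 0))) /=.
  rewrite (bigD1 (r, s)) //= eqxx [X in _ + X]big1 ?addr0 => [|q /negPf qrs].
    by rewrite {1}[omega _ _ _ _](fP i).1.2.
  by apply: big1 => l _; rewrite eq_sym qrs scaler0.
(* t(a) is the trace of c |-> a c ey, now computed in the lifted dual system, where it splits into
   blocks. *)
rewrite -(tgr_trace_mull_mulr n_unit Ty a sysF) sum_sig; apply: eq_bigr => i _.
set m := omega (b i) a; set n := omega (b i) ey.
(* If [N] is concentrated in entry (r, s) with value u, then the entry (r, s) of [m *m N *m n] is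
   m_rr u n_ss. *)
transitivity (\sum_r \sum_s \sum_l f i l (m r r * u i l * n s s)).
  transitivity (\sum_(q : 'I_(x i) * 'I_(x i)) \sum_(l : J i)
      F (Tagged I (q, l)) (a * U (Tagged I (q, l)) * ey)).
    by rewrite pair_bigA; apply: eq_bigr => -[].
  rewrite [RHS]pair_bigA.
  apply: eq_bigr => -[r s] _ /=; apply: eq_bigr => l _; rewrite /F /=; congr (f i l _).
  rewrite !omegaM -/m -/n UE /M dfwith_in /=; set N := \matrix_(_, _) _.
  have NE r' s' : N r' s' = if (r', s') == (r, s) then u i l else 0 by rewrite mxE.
  rewrite mxE (bigD1 s) //= [X in _ + X]big1 => [|s' /negPf ss'].
    rewrite addr0 mxE (bigD1 r) //= [X in _ + X]big1 => [|r' /negPf rr'].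
      by rewrite addr0 NE eqxx.
    by rewrite NE xpair_eqE rr' mulr0.
  by rewrite mxE big1 ?mul0r // => r' _; rewrite NE xpair_eqE ss' andbF mulr0.
(* The sum over l is Tr(trd(m_rr) trd(n_ss)), so summing over both diagonals yields the product of
   trd(\tr m) and trd(\tr n). *)
under eq_bigr => r _ do under eq_bigr => s _ do rewrite (fP i).2.
have trS := reduced_trace_sum (@endo_field _ _ (X i)) (trd_red i).
under eq_bigr => r _.
  rewrite -(scalar_sum_of _ (@field_trace_scalar _ _)) -mulr_sumr -trS.
  over.
rewrite -(scalar_sum_of _ (@field_trace_scalar _ _)) -mulr_suml -trS.
(* The factor coming from [ey] is the scalar (x d / h) T(y), and T(y) = 1/n. *)
rewrite -/(\tr m) -/(\tr n) (reduced_trace_omega n_unit (b i) (d_sqr i) (trd_red i)) Ty.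
by rewrite mulr_algr (scalarZ_of _ _ (@field_trace_scalar _ _)) [_^-1 * _]mulrC.
Qed.
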